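(* Let $\eta\in\mathbb{C}\setminus\{0\}$ be fixed and let $a_0(z),\dots,a_n(z)$ be polynomials, not all identically zero. Let $f$ be a transcendental entire solution of the difference equation $$a_n(z)\Delta^n f(z)+\cdots+a_1(z)\Delta f(z)+a_0(z)f(z)=0$$ with order $\sigma(f)<1$. Then $\sigma(f)=\chi$, where $\chi$ is a rational number which is a gradient of the Newton–Puiseux diagram of the equation. In particular, $\chi>0$.
   Context: For the fixed non-zero complex number $\eta$, $\Delta f(z)=f(z+\eta)-f(z)$ and $\Delta^n f=\Delta(\Delta^{n-1}f)$ for integers $n\ge 2$. The order $\sigma(f)$ is the usual order of growth, $\limsup_{r\to\infty}\log\log M(r,f)/\log r$ with $M(r,f)=\max_{|z|=r}|f(z)|$. The Newton–Puiseux diagram of the equation is the upper boundary of the convex hull of the points $(j,\,A_j-j)$, $0\le j\le n$, $a_j\not\equiv 0$, where $A_j=\deg a_j$; its gradients are the numbers $\chi=-s$, where $s$ is the slope of an edge of this upper boundary. Equivalently, $\chi$ is a gradient if and only if the maximum over $\{j: a_j\not\equiv 0\}$ of $j\chi+A_j-j$ is attained for at least two distinct values of $j$. *)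

(* Defs.v *)
From HB Require Import structures.
From mathcomp Require Import all_boot all_order all_algebra.
From mathcomp Require Import complex.
From mathcomp Require Import all_classical all_reals all_analysis.

Set Implicit Arguments.
Unset Strict Implicit.
Unset Printing Implicit Defensive.

Import Order.TTheory GRing.Theory Num.Theory.
Import numFieldNormedType.Exports.

Local Open Scope classical_set_scope.
Local Open Scope ring_scope.
Local Open Scope complex_scope.
Local Open Scope convex_scope.

(* [R[i]^o] is [R[i]] as a normed module over itself, with the topology of its
   modulus, so [derivable f z 1] is complex differentiability at [z]. *)
Definition entire (R : realType) (f : R[i] -> R[i]) : Prop :=
  forall z : R[i], @derivable R[i] R[i]^o R[i]^o f z 1.

Definition transcendental_entire (R : realType) (f : R[i] -> R[i]) : Prop :=
  entire f /\ ~ exists p : {poly R[i]}, forall z, f z = p.[z].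

(* [normc] is the [R]-valued modulus; the generic norm [`|z|] has values in
   [R[i]].  For [f] continuous and [0 <= r] the supremum is a maximum. *)
Definition max_modulus (R : realType) (f : R[i] -> R[i]) (r : R) : R :=
  sup [set ComplexField.Normc.normc (f z) | z in
        [set z : R[i] | ComplexField.Normc.normc z = r]].

(* [ln] is zero on nonpositive reals; for entire [f] this only matters when [f] is
   constant, since otherwise [ln (max_modulus f r)] is eventually positive. *)
Definition growth_order (R : realType) (f : R[i] -> R[i]) : \bar R :=
  limf_esup (fun r : R => (ln (ln (max_modulus f r)) / ln r)%:E) +oo.

Definition difference (C : zmodType) (eta : C) (f : C -> C) : C -> C :=
  fun z => f (z + eta) - f z.

Definition convex_hull (R : numDomainType) (M : lmodType R) (A : set M) :
    set M :=
  smallest (@convex_set R M) A.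

Definition upper_boundary (R : realType) (A : set (R^o * R^o)%type) :
    set (R^o * R^o)%type :=
  [set p | A p /\ forall y : R, A (p.1, y) -> y <= p.2].

(* Any nondegenerate segment contained in the upper boundary of a polygon is
   part of an edge, so the segment is not required to be maximal.  The condition
   [p.1 < q.1] also excludes vertical segments. *)
Definition upper_edge_slope (R : realType) (A : set (R^o * R^o)%type) (s : R) :
    Prop :=
  exists p q : convex_lmodType (R^o * R^o)%type,
    [/\ p.1 < q.1,
        forall t : {i01 R}, upper_boundary A (p <| t |> q) &
        s = (q.2 - p.2) / (q.1 - p.1)].

Definition newton_puiseux_points (R : realType) (n : nat)
    (a : 'I_n.+1 -> {poly R[i]}) : set (R^o * R^o)%type :=
  [set (j%:R, (size (a j)).-1%:R - j%:R) | j in [set j | a j != 0]].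

Definition newton_puiseux_gradient (R : realType) (n : nat)
    (a : 'I_n.+1 -> {poly R[i]}) (chi : R) : Prop :=
  exists2 s : R,
    upper_edge_slope (convex_hull (newton_puiseux_points a)) s & chi = - s.

(* Main.v *)
(* Write [f z = \sum_m c_m z^m] and let [N = N(r)] be a central index, i.e. an index
   maximizing [|c_m| r^m].  The order of [f] is the upper limit of [ln N / ln r], so
   [N / r -> 0] as the order is less than 1.  In the power series of
   [a_j(z) Delta^j f(z)] the dominant contribution of [c_N] has size comparable to
   [(N / r)^j r^(deg a_j)], that is [N^j r^(deg a_j - j)], relative to [|c_N| r^N], and
   the maximality of [|c_N| r^N] bounds everything else by a multiple of the same
   quantities.  Hence for no large [r] can a single [j] dominate; letting [r] tend
   to infinity along radii where [ln N / ln r] tends to the order [chi], the maximum of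
   [j chi + deg a_j - j] is attained twice.  If [chi = 0], the largest maximizing [j]
   would still dominate because [N] tends to infinity.

   The Taylor expansion is obtained without integration: Goursat's bisection is
   applied to trapezoidal sums on polar grids, which yields the inequality between
   [|f(z0)|] and the maximum of [|f|] on a circle around [z0]; this gives removable
   singularities and then the iterated quotients [(f(z) - f(0)) / z]. *)

Require Import Defs.
From HB Require Import structures.
From mathcomp Require Import all_boot all_order all_algebra.
From mathcomp Require Import complex.
From mathcomp Require Import all_classical all_reals all_analysis.
From mathcomp Require Import ring lra zify.

Set Implicit Arguments.
Unset Strict Implicit.
Unset Printing Implicit Defensive.

Import Order.TTheory GRing.Theory Num.Theory.
Import numFieldNormedType.Exports.

Local Open Scope ring_scope.
Local Open Scope complex_scope.

(** The classical route through Wiman-Valiron theory compares values of [f] and of its differences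
    near a point of maximum modulus and has to avoid exceptional radii. Comparing a single
    coefficient of the equation works at every large radius, and only the central index enters. The
    equation is not rearranged as a power series: the operator acts on Taylor polynomials, whose
    coefficients are finite sums, and the truncation error tends to zero in each fixed coefficient.

    Polar grids are used because [dz / z] is invariant under scaling and rotation: all edges in one
    direction carry the same weight, and around a full annulus the two radial sides cancel. What
    remains compares averages over two circles, and shrinking the inner one gives the mean
    inequality, which replaces Cauchy's formula. The replacement loses factors such as [2 ^ m]; they
    are recovered by reading the maximum modulus at a radius enlarged by a fixed factor, which
    leaves the order unchanged. *)

Section Modulus.
Variable R : realType.
Implicit Types (z w : R[i]) (x y t : R).

Definition modulus z : R := ComplexField.Normc.normc z.

Lemma modulusE z : `|z| = (modulus z)%:C.
Proof. by rewrite normc_def /modulus; case: z. Qed.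

Lemma modulus_ge0 z : 0 <= modulus z.
Proof. by rewrite -lecR -modulusE normr_ge0. Qed.

Lemma modulus0 : modulus 0 = 0.
Proof. exact: ComplexField.Normc.normc0. Qed.

Lemma modulus1 : modulus 1 = 1.
Proof. exact: ComplexField.Normc.normc1. Qed.

Lemma modulusM z w : modulus (z * w) = modulus z * modulus w.
Proof. exact: ComplexField.Normc.normcM. Qed.

Lemma modulusV z : modulus z^-1 = (modulus z)^-1.
Proof. exact: ComplexField.Normc.normcV. Qed.

Lemma modulusX z k : modulus (z ^+ k) = modulus z ^+ k.
Proof.
by elim: k => [|k IH]; rewrite ?expr0 ?modulus1 // !exprS modulusM IH.
Qed.

Lemma modulusD z w : modulus (z + w) <= modulus z + modulus w.
Proof. by rewrite -lecR rmorphD /= -!modulusE ler_normD. Qed.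

Lemma modulusN z : modulus (- z) = modulus z.
Proof. by apply: complexI; rewrite -!modulusE normrN. Qed.

Lemma modulusBC z w : modulus (z - w) = modulus (w - z).
Proof. by rewrite -modulusN opprB. Qed.

Lemma modulusB z w : modulus (z - w) <= modulus z + modulus w.
Proof. by rewrite -(modulusN w) modulusD. Qed.

Lemma modulusB_ge z w : modulus z - modulus w <= modulus (z - w).
Proof. by rewrite lerBlDr -{1}(subrK w z) modulusD. Qed.

Lemma modulusD_ge z w : modulus z - modulus w <= modulus (z + w).
Proof. by rewrite -[w in z + w]opprK -(modulusN w) modulusB_ge. Qed.

Lemma modulus_eq0 z : (modulus z == 0) = (z == 0).
Proof.
apply/eqP/eqP => [|->]; last exact: modulus0.
exact: ComplexField.Normc.eq0_normc.
Qed.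

Lemma modulus_gt0 z : (0 < modulus z) = (z != 0).
Proof. by rewrite lt_neqAle modulus_ge0 andbT eq_sym modulus_eq0. Qed.

Lemma modulus_real x : modulus x%:C = `|x|.
Proof. by rewrite /modulus /= expr0n /= addr0 sqrtr_sqr. Qed.

Lemma modulus_nat k : modulus k%:R = k%:R.
Proof. by rewrite -(rmorph_nat (real_complex R)) modulus_real normr_nat. Qed.

Lemma modulus_sum (I : Type) (s : seq I) (P : pred I) (F : I -> R[i]) :
  modulus (\sum_(i <- s | P i) F i) <= \sum_(i <- s | P i) modulus (F i).
Proof.
elim/big_rec2: _ => [|i u v _ h]; first by rewrite modulus0.
by rewrite (le_trans (modulusD _ _)) ?lerD.
Qed.

Lemma Re_le_modulus z : `|complex.Re z| <= modulus z.
Proof. by rewrite -lecR -modulusE normc_ge_Re. Qed.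

Lemma modulus_Re_Im z : modulus z <= `|complex.Re z| + `|complex.Im z|.
Proof.
rewrite {1}[z]complexE (le_trans (modulusD _ _)) // modulusM !modulus_real.
suff -> : modulus 'i = 1 by rewrite mul1r.
by rewrite /modulus /= expr0n /= expr1n add0r sqrtr1.
Qed.

Lemma Im_le_modulus z : `|complex.Im z| <= modulus z.
Proof.
case: z => a b /=; rewrite -(sqrtr_sqr b) ler_wsqrtr // lerDr sqr_ge0 //.
Qed.

Definition ccont (f : R[i] -> R[i]) z := forall e, 0 < e ->
  exists2 d, 0 < d & forall w, modulus (w - z) < d -> modulus (f w - f z) < e.

(** Written without a quotient, so that [w = z] is no exception. *)
Definition cderiv (f : R[i] -> R[i]) z (l : R[i]) := forall e, 0 < e ->
  exists2 d, 0 < d & forall w, modulus (w - z) < d ->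
    modulus (f w - f z - l * (w - z)) <= e * modulus (w - z).

Definition holo (f : R[i] -> R[i]) z := @derivable R[i] R[i]^o R[i]^o f z 1.

Lemma ccontP (f : R[i] -> R[i]) z :
  {for z, continuous (f : R[i]^o -> R[i]^o)} <-> ccont f z.
Proof.
split=> [/cvgrPdist_lt fz e e0|fz].
  have /fz : 0 < e%:C by rewrite ltcR.
  case/nbhs_ballP => d /= d0 dP; have d0' := d0.
  move: d0; rewrite ltcE /= => /andP[/eqP id d0].
  exists (complex.Re d) => // w wz; rewrite -ltcR -modulusE distrC.
  apply: dP; rewrite /ball /= distrC modulusE ltcE /= wz andbT id //.
apply/(@cvgrPdist_lt _ R[i]^o _ (nbhs (z : R[i]^o)) _ f (f z)) => e; rewrite ltcE /= =>
  /andP[/eqP ie e0].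
have [d d0 dP] := fz _ e0.
apply/(@nbhs_ballP _ R[i]^o); exists d%:C; rewrite /= ?ltcR // => w.
rewrite /ball /= distrC modulusE ltcR => /dP h.
by rewrite distrC modulusE ltcE /= h andbT ie.
Qed.

Lemma holo_cderiv (f : R[i] -> R[i]) z : holo f z <-> exists l, cderiv f z l.
Proof.
split=> [/cvg_ex[l /cvgrPdist_le fz]|[l fz]].
  exists l => e e0; have /fz : 0 < e%:C by rewrite ltcR.
  case/nbhs_ballP => d /= d0 dP; move: d0; rewrite ltcE /= => /andP[/eqP id d0].
  exists (complex.Re d) => // w wz.
  have [->|wNz] := eqVneq w z; first by rewrite !subrr mulr0 subr0 modulus0 mulr0.
  have wz0 : w - z != 0 by rewrite subr_eq0.
  have /dP/(_ wz0) : ball (0 : R[i]^o) d (w - z).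
    by rewrite /ball /= distrC subr0 modulusE ltcE /= wz id andbT.
  rewrite /= /shift /= -[(w - z) *: 1]/((w - z) * 1) mulr1 subrK modulusE lecR.
  rewrite /GRing.scale /= => h.
  have -> : f w - f z - l * (w - z) = - ((l - (w - z)^-1 * (f w - f z)) * (w - z)).
    by field.
  by rewrite modulusN modulusM ler_wpM2r ?modulus_ge0.
apply/cvg_ex; exists l; apply/(@cvgrPdist_le _ R[i]^o) => e.
rewrite ltcE /= => /andP[/eqP ie e0].
have [d d0 dP] := fz _ e0.
apply/(@nbhs_ballP _ R[i]^o); exists d%:C; rewrite /= ?ltcR // => h hd h0.
have {}hd : modulus h < d.
  by move: hd; rewrite /ball /= distrC subr0 modulusE ltcR.
have := dP (h + z); rewrite addrK => /(_ hd) k.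
rewrite modulusE lecE /= ie eqxx /=.
rewrite /shift /= -[h *: 1]/(h * 1) mulr1 /GRing.scale /=.
have h0' : 0 < modulus h by rewrite modulus_gt0.
rewrite -(ler_pM2r h0') -modulusM; apply: le_trans k.
rewrite -modulusN le_eqVlt; apply/orP; left; apply/eqP; congr modulus.
by field.
Qed.

Lemma holo_ccont (f : R[i] -> R[i]) z : holo f z -> ccont f z.
Proof.
by move=> /derivable1_diffP /differentiable_continuous /ccontP.
Qed.

End Modulus.

(** * Contour sums and the mean inequality *)

Section Bisection.
Variable R : realType.

Lemma exp2_gt0 k : 0 < 2 ^+ k :> R.
Proof. by rewrite exprn_gt0. Qed.

(** Passing from [a n] to [a n.+1] chooses a half of the current dyadic interval; the supremum of
    the left ends lies in all of them. *)
Lemma nested_dyadic (a : nat -> nat) :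
  (forall n, exists i : bool, a n.+1 = (2 * a n + i)%N) ->
  exists x : R, forall n, (a n)%:R / 2 ^+ n <= x <= (a n).+1%:R / 2 ^+ n.
Proof.
move=> aS.
have lo n : (a n)%:R / 2 ^+ n <= (a n.+1)%:R / 2 ^+ n.+1 :> R.
  have [i ->] := aS n.
  rewrite ler_pdivrMr ?exp2_gt0 // exprS invfM natrD natrM.
  rewrite mulrA mulfVK ?gt_eqF ?exp2_gt0 //.
  by rewrite ler_pdivlMr // mulrC lerDl ler0n.
have hi n : (a n.+1).+1%:R / 2 ^+ n.+1 <= (a n).+1%:R / 2 ^+ n :> R.
  have [i ->] := aS n.
  rewrite ler_pdivlMr ?exp2_gt0 // exprS invfM mulrA mulfVK ?gt_eqF ?exp2_gt0 //.
  rewrite ler_pdivrMr // -natrM ler_nat; case: i; lia.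
have lom n m : (n <= m)%N -> (a n)%:R / 2 ^+ n <= (a m)%:R / 2 ^+ m :> R.
  elim: m => [|m IH]; first by rewrite leqn0 => /eqP ->.
  rewrite leq_eqVlt => /orP[/eqP -> //|]; rewrite ltnS => /IH h.
  exact: le_trans h (lo m).
have him n m : (n <= m)%N -> (a m).+1%:R / 2 ^+ m <= (a n).+1%:R / 2 ^+ n :> R.
  elim: m => [|m IH]; first by rewrite leqn0 => /eqP ->.
  rewrite leq_eqVlt => /orP[/eqP -> //|]; rewrite ltnS => /IH h.
  exact: le_trans (hi m) h.
have lohi n m : (a n)%:R / 2 ^+ n <= (a m).+1%:R / 2 ^+ m :> R.
  have step k : (a k)%:R / 2 ^+ k <= (a k).+1%:R / 2 ^+ k :> R.
    by rewrite ler_pM2r ?invr_gt0 ?exp2_gt0 // ler_nat.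
  have [nm|/ltnW mn] := leqP n m; first exact: le_trans (lom _ _ nm) (step _).
  exact: le_trans (step _) (him _ _ mn).
pose A := range (fun n => (a n)%:R / 2 ^+ n : R).
exists (sup A) => n; apply/andP; split.
  apply: sup_upper_bound; last by exists n.
  split; first by exists ((a 0)%:R / 2 ^+ 0), 0%N.
  by exists ((a 0).+1%:R / 2 ^+ 0) => _ [m _ <-]; exact: lohi.
apply: ge_sup; first by exists ((a 0)%:R / 2 ^+ 0), 0%N.
by move=> _ [m _ <-]; exact: lohi.
Qed.

(** Closed at both ends, since the limit of a bisection may be an endpoint. *)
Definition dyadic_in (x : R) l a := a%:R / 2 ^+ l <= x <= a.+1%:R / 2 ^+ l.

(** Compactness of the unit square: [P l a b] speaks of the cell of side [2 ^- l] with lower corner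
    [(a, b) / 2 ^ l]. If [P] failed for the whole square, it would fail along a chain of cells
    shrinking to a point, against the local hypothesis there. *)
Lemma bisection (P : nat -> nat -> nat -> Prop) :
  (forall l a b, P l.+1 (2 * a)%N (2 * b)%N -> P l.+1 (2 * a).+1 (2 * b)%N ->
     P l.+1 (2 * a)%N (2 * b).+1 -> P l.+1 (2 * a).+1 (2 * b).+1 -> P l a b) ->
  (forall x y : R, exists l0, forall l a b, (l0 <= l)%N ->
     dyadic_in x l a -> dyadic_in y l b -> P l a b) ->
  P 0 0 0.
Proof.
move=> Psplit Ploc; apply: contrapT => nP0.
have /choice[step stepP] : forall c : nat * (nat * nat),
    exists r : nat * nat, ~ P c.1 c.2.1 c.2.2 -> ~ P c.1.+1 r.1 r.2 /\
    exists i j : bool, r = ((2 * c.2.1 + i)%N, (2 * c.2.2 + j)%N).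
  move=> [l [a b]] /=.
  have [Pl|nPl] := pselect (P l a b); first by exists (0%N, 0%N).
  apply: contrapT => /forallNP h; apply: nPl.
  have {}h (i j : bool) : P l.+1 (2 * a + i)%N (2 * b + j)%N.
    apply: contrapT => nP; apply: (h ((2 * a + i)%N, (2 * b + j)%N)) => _.
    by split=> //; exists i, j.
  apply: Psplit; first by have := h false false; rewrite !addn0.
  - by have := h true false; rewrite addn0 addn1.
  - by have := h false true; rewrite addn0 addn1.
  - by have := h true true; rewrite !addn1.
(* The chain of failing cells, each a quarter of its predecessor. *)
pose s := fix s n := if n is m.+1 then step (m, s m) else (0%N, 0%N).
have sP n : ~ P n (s n).1 (s n).2.
  by elim: n => // n IH; have [] := stepP (n, s n) IH.
have sS n := (stepP (n, s n) (sP n)).2.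
have [x xP] : exists x : R, forall n, dyadic_in x n (s n).1.
  by apply: nested_dyadic => n; have [i [j e]] := sS n; exists i; rewrite /= e.
have [y yP] : exists x : R, forall n, dyadic_in x n (s n).2.
  by apply: nested_dyadic => n; have [i [j e]] := sS n; exists j; rewrite /= e.
have [l0 /(_ l0 _ _ (leqnn _) (xP l0) (yP l0))] := Ploc x y.
exact: sP.
Qed.

Lemma inv_exp2_small (e : R) : 0 < e ->
  exists l0, forall l, (l0 <= l)%N -> (2 ^+ l)^-1 < e.
Proof.
move=> e0; exists (Num.trunc e^-1).+1 => l ll.
rewrite invf_plt ?posrE ?exp2_gt0 //.
have h : e^-1 < (Num.trunc e^-1).+1%:R by exact: Num.Theory.truncnS_gt.
apply: lt_le_trans h _; rewrite -natrX ler_nat (leq_trans ll) //.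
exact: ltnW (ltn_expl _ _).
Qed.

End Bisection.

Section Grid.
Variables (R : realType).
Local Notation C := R[i].
Variables (tau sigma : C).

Definition hside (g : nat -> nat -> C) a b n :=
  \sum_(i < n) (g (a + i)%N b + g (a + i).+1 b).
Definition vside (g : nat -> nat -> C) a b n :=
  \sum_(j < n) (g a (b + j)%N + g a (b + j).+1).

(** Counterclockwise: bottom minus top, right minus left. The factor 1/2 of the trapezoidal rule is
    absorbed in the weights. *)
Definition contour g a b n : C :=
  tau * (hside g a b n - hside g a (b + n) n) +
  sigma * (vside g (a + n) b n - vside g a b n).

Lemma hsideD g a b m n : hside g a b (m + n) = hside g a b m + hside g (a + m) b n.
Proof.
by rewrite /hside big_split_ord; congr (_ + _); apply: eq_bigr => i _; rewrite /= ?addnA.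
Qed.

Lemma vsideD g a b m n : vside g a b (m + n) = vside g a b m + vside g a (b + m) n.
Proof.
by rewrite /vside big_split_ord; congr (_ + _); apply: eq_bigr => i _; rewrite /= ?addnA.
Qed.

Lemma hsideS g a b n :
  hside g a b n.+1 = hside g a b n + (g (a + n)%N b + g (a + n).+1 b).
Proof. by rewrite /hside big_ord_recr. Qed.

Lemma vsideS g a b n :
  vside g a b n.+1 = vside g a b n + (g a (b + n)%N + g a (b + n).+1).
Proof. by rewrite /vside big_ord_recr. Qed.

(** Edges shared by two of the four blocks are traversed in opposite directions and cancel. *)
Lemma contour_split g a b m : contour g a b (m + m) =
  contour g a b m + contour g (a + m) b m +
  contour g a (b + m) m + contour g (a + m) (b + m) m.
Proof. by rewrite /contour !hsideD !vsideD -!addnA; ring. Qed.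

Lemma contourD g1 g2 a b n :
  contour (fun i j => g1 i j + g2 i j) a b n = contour g1 a b n + contour g2 a b n.
Proof.
have hD a' b' : hside (fun i j => g1 i j + g2 i j) a' b' n =
    hside g1 a' b' n + hside g2 a' b' n.
  by rewrite /hside -big_split; apply: eq_bigr => i _ /=; ring.
have vD a' b' : vside (fun i j => g1 i j + g2 i j) a' b' n =
    vside g1 a' b' n + vside g2 a' b' n.
  by rewrite /vside -big_split; apply: eq_bigr => i _ /=; ring.
by rewrite /contour !hD !vD; ring.
Qed.

Lemma contour_cst c a b n : contour (fun _ _ => c) a b n = 0.
Proof. by rewrite /contour /hside /vside !subrr !mulr0 addr0. Qed.

(* The edge weights [tau] and [sigma] make the trapezoidal rule for [f dz / z]
   exact on affine [f] when the grid is geometric. *)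
Lemma contour_linear c (z : nat -> nat -> C) a b n :
  (forall i j, tau * (z i j + z i.+1 j) = z i.+1 j - z i j) ->
  (forall i j, sigma * (z i j + z i j.+1) = z i j.+1 - z i j) ->
  contour (fun i j => c * z i j) a b n = 0.
Proof.
move=> zh zv.
have hE a' b' m : tau * hside (fun i j => c * z i j) a' b' m =
    c * (z (a' + m)%N b' - z a' b').
  elim: m => [|m IH]; first by rewrite /hside big_ord0 mulr0 addn0 subrr mulr0.
  rewrite hsideS mulrDr IH -mulrDr mulrCA zh addnS; ring.
have vE a' b' m : sigma * vside (fun i j => c * z i j) a' b' m =
    c * (z a' (b' + m)%N - z a' b').
  elim: m => [|m IH]; first by rewrite /vside big_ord0 mulr0 addn0 subrr mulr0.
  rewrite vsideS mulrDr IH -mulrDr mulrCA zv addnS; ring.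
by rewrite /contour !mulrBr !hE !vE; ring.
Qed.

Lemma contour_bound g a b n (B : R) :
  (forall i j, (a <= i <= a + n)%N -> (b <= j <= b + n)%N -> modulus (g i j) <= B) ->
  modulus (contour g a b n) <= 4 * n%:R * B * (modulus tau + modulus sigma).
Proof.
move=> gB.
have hB b' : (b' = b \/ b' = b + n)%N -> modulus (hside g a b' n) <= n%:R * (2 * B).
  move=> hb; rewrite /hside (le_trans (modulus_sum _ _ _)) //.
  rewrite (le_trans (_ : _ <= \sum_(i < n) (2 * B))) //; last first.
    by rewrite sumr_const card_ord -[leLHS]mulr_natl.
  apply: ler_sum => i _; rewrite (le_trans (modulusD _ _)) // mulr2n mulrDl mul1r.
  by have := ltn_ord i; case: hb => -> ?; rewrite lerD ?gB //; lia.
have vB a' : (a' = a \/ a' = a + n)%N -> modulus (vside g a' b n) <= n%:R * (2 * B).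
  move=> hb; rewrite /vside (le_trans (modulus_sum _ _ _)) //.
  rewrite (le_trans (_ : _ <= \sum_(i < n) (2 * B))) //; last first.
    by rewrite sumr_const card_ord -[leLHS]mulr_natl.
  apply: ler_sum => i _; rewrite (le_trans (modulusD _ _)) // mulr2n mulrDl mul1r.
  by have := ltn_ord i; case: hb => -> ?; rewrite lerD ?gB //; lia.
rewrite /contour (le_trans (modulusD _ _)) // !modulusM mulrDr.
rewrite [modulus tau * _]mulrC [modulus sigma * _]mulrC lerD // ler_wpM2r ?modulus_ge0 //;
  apply: le_trans (modulusB _ _) _.
- have -> : 4 * n%:R * B = n%:R * (2 * B) + n%:R * (2 * B) by ring.
  by apply: lerD; apply: hB; auto.
- have -> : 4 * n%:R * B = n%:R * (2 * B) + n%:R * (2 * B) by ring.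
  by apply: lerD; apply: vB; auto.
Qed.

End Grid.

(** * Logarithmic polar coordinates *)

Section Polar.
Variable R : realType.
Implicit Types (s t : R).

Lemma cos_lipschitz s t : `|cos s - cos t| <= `|s - t|.
Proof.
wlog st : s t / s <= t => [h|].
  by have [/h //|/ltW /h] := leP s t; rewrite distrC [leRHS]distrC.
have [c _ e] := MVT_segment st (fun x _ => is_derive_cos x)
  (continuous_subspaceT (@continuous_cos R)).
by rewrite distrC e normrM normrN [leRHS]distrC ler_piMl // sin_max.
Qed.

Lemma sin_lipschitz s t : `|sin s - sin t| <= `|s - t|.
Proof.
wlog st : s t / s <= t => [h|].
  by have [/h //|/ltW /h] := leP s t; rewrite distrC [leRHS]distrC.
have [c _ e] := MVT_segment st (fun x _ => is_derive_sin x)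
  (continuous_subspaceT (@continuous_sin R)).
by rewrite distrC e normrM [leRHS]distrC ler_piMl // cos_max.
Qed.

Lemma expR_lipschitz (S s t : R) : s <= S -> t <= S ->
  `|expR s - expR t| <= expR S * `|s - t|.
Proof.
wlog st : s t / t <= s => [h sS tS|sS tS].
  have [/h ->//|/ltW st] := leP t s; rewrite distrC [`|s - t|]distrC; exact: h.
rewrite !ger0_norm ?subr_ge0 ?ler_expR //.
have h := expR_ge1Dx (t - s).
have -> : expR t = expR s * expR (t - s) by rewrite -expRD addrC subrK.
apply: le_trans (_ : expR s * (s - t) <= _); last first.
  by rewrite ler_wpM2r ?subr_ge0 // ler_expR.
rewrite -{1}[expR s]mulr1 -mulrBr ler_wpM2l ?expR_ge0 //; lra.
Qed.

(** The complex exponential of [s + it]. As [s] is the logarithm of the modulus, equidistant grids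
    in [(s, t)] become geometric grids. *)
Definition polar s t : R[i] := (expR s)%:C * (cos t +i* sin t).

Lemma polarD s s' t t' : polar (s + s') (t + t') = polar s t * polar s' t'.
Proof.
rewrite /polar expRD rmorphM /= cosD sinD.
have -> : (cos t * cos t' - sin t * sin t') +i* (sin t * cos t' + cos t * sin t')
  = (cos t +i* sin t) * (cos t' +i* sin t') :> R[i].
  by apply/eqP; rewrite eq_complex /=; apply/andP; split; apply/eqP; ring.
by ring.
Qed.

Lemma polar00 : polar 0 0 = 1.
Proof. by rewrite /polar expR0 cos0 sin0 mul1r. Qed.

Lemma modulus_polar s t : modulus (polar s t) = expR s.
Proof.
rewrite /polar modulusM modulus_real ger0_norm ?expR_ge0 //.
by rewrite /modulus /= cos2Dsin2 sqrtr1 mulr1.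
Qed.

Lemma polar_neq0 s t : polar s t != 0.
Proof. by rewrite -modulus_gt0 modulus_polar expR_gt0. Qed.

Lemma polar_lipschitz (S s s' t t' : R) : s <= S -> s' <= S ->
  modulus (polar s t - polar s' t') <= 2 * expR S * (`|s - s'| + `|t - t'|).
Proof.
move=> sS s'S.
have -> : polar s t - polar s' t' = (expR s - expR s')%:C * (cos t +i* sin t) +
    (expR s')%:C * ((cos t - cos t') +i* (sin t - sin t')).
  rewrite /polar; apply/eqP; rewrite eq_complex /=.
  by apply/andP; split; apply/eqP; ring.
rewrite (le_trans (modulusD _ _)) // !modulusM !modulus_real.
have -> : modulus (cos t +i* sin t) = 1 by rewrite /modulus /= cos2Dsin2 sqrtr1.
have h1 := expR_lipschitz sS s'S.
have h2 : modulus ((cos t - cos t') +i* (sin t - sin t')) <= 2 * `|t - t'|.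
  apply: le_trans (modulus_Re_Im _) _ => /=.
  by rewrite mulr2n mulrDl mul1r lerD ?cos_lipschitz ?sin_lipschitz.
have h3 : `|expR s'| <= expR S by rewrite ger0_norm ?expR_ge0 // ler_expR.
rewrite mulr1 mulrDr lerD //.
  apply: le_trans h1 _; rewrite ler_wpM2r ?normr_ge0 // ler_peMl ?expR_ge0 //.
  by rewrite ler1n.
rewrite [2 * _]mulrC -mulrA; apply: ler_pM => //; exact: modulus_ge0.
Qed.

Lemma polar_natmul s t k : polar (k%:R * s) (k%:R * t) = polar s t ^+ k.
Proof.
elim: k => [|k IH]; first by rewrite !mul0r polar00 expr0.
by rewrite exprSr -IH -polarD -natr1 !mulrDl !mul1r.
Qed.

Lemma polar_pi : polar 0 pi = -1.
Proof. by rewrite /polar expR0 cospi sinpi mul1r; apply/eqP; rewrite eq_complex /= !oppr0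
  !eqxx. Qed.

End Polar.

(** * Goursat's theorem on an annulus *)

Section Goursat.
Variable R : realType.
Local Notation C := R[i].

Lemma trapezoid_polar (q z : C) : q + 1 != 0 ->
  (q - 1) / (q + 1) * (z + z * q) = z * q - z.
Proof. by move=> q1; field. Qed.

Lemma modulus_add1_ge1 (z : C) : 0 <= complex.Re z -> 1 <= modulus (z + 1).
Proof.
move=> rz; apply: le_trans (_ : complex.Re (z + 1) <= _).
  by case: z rz => a b /=; rewrite lerDr.
exact: le_trans (ler_norm _) (Re_le_modulus _).
Qed.

Lemma modulus_exp_sub1 (z : C) k : modulus z = 1 ->
  modulus (z ^+ k - 1) <= k%:R * modulus (z - 1).
Proof.
move=> z1; rewrite subrX1 modulusM mulrC ler_wpM2r ?modulus_ge0 //.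
apply: le_trans (modulus_sum _ _ _) _.
under eq_bigr do rewrite modulusX z1 expr1n.
by rewrite sumr_const card_ord.
Qed.

Variables (f : C -> C) (s1 L : R).
Hypotheses (L0 : 0 <= L) (fd : forall z, z != 0 -> holo f z).

(** At level [k] the annulus with logarithmic radii from [s1] to [s1 + L] is cut into [2 ^ k] by
    [2 ^ k] cells; [q] and [om] are the ratios of neighbouring nodes. *)
Let step_r k := L / 2 ^+ k.
Let step_a k : R := 2 * pi / 2 ^+ k.
Let node k i j := polar (s1 + i%:R * step_r k) (j%:R * step_a k).
Let q k := polar (step_r k) 0.
Let om k := polar 0 (step_a k).
Let tau k := (q k - 1) / (q k + 1).
Let sig k := (om k - 1) / (om k + 1).
Let grid k i j := f (node k i j).

Let nodeSr k i j : node k i.+1 j = node k i j * q k.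
Proof. by rewrite /node /q -polarD addr0 -natr1 mulrDl mul1r addrA. Qed.

Let nodeSa k i j : node k i j.+1 = node k i j * om k.
Proof. by rewrite /node /om -polarD addr0 -natr1 mulrDl mul1r. Qed.

Let Re_q k : 0 <= complex.Re (q k).
Proof. by rewrite /q /polar cos0 sin0 /= mulr1 mul0r subr0 expR_ge0. Qed.

Let step_a_ge0 k : 0 <= step_a k.
Proof. by rewrite /step_a divr_ge0 ?exprn_ge0 // mulr_ge0 // pi_ge0. Qed.

(** From level 2 on the angular step is at most a right angle, which keeps the denominator
    [om k + 1] of [sig k] away from zero. *)
Let Re_om k : (2 <= k)%N -> 0 <= complex.Re (om k).
Proof.
move=> k2; rewrite /om /polar expR0 mul1r /= cos_ge0_pihalf //.
apply/andP; split.
  by rewrite (le_trans _ (step_a_ge0 k)) // oppr_le0 divr_ge0 ?pi_ge0.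
rewrite /step_a ler_pdivrMr ?exp2_gt0 //.
have h : (2 ^+ 2 : R) <= 2 ^+ k by rewrite ler_eXn2l // ltr1n.
have := ler_wpM2l (pi_ge0 R) h; lra.
Qed.

Let W := 2 * expR L * (L + 2 * pi).

Let W_ge0 : 0 <= W.
Proof. by rewrite !mulr_ge0 ?expR_ge0 // addr_ge0 // mulr_ge0 // pi_ge0. Qed.

Let div_le1 (a b : C) (B : R) : modulus a <= B -> 1 <= modulus b ->
  modulus (a / b) <= B.
Proof.
move=> aB b1; rewrite modulusM modulusV ler_pdivrMr ?(lt_le_trans ltr01) //.
by rewrite (le_trans aB) // ler_peMr // (le_trans (modulus_ge0 a)).
Qed.

Let weights_le k : (2 <= k)%N -> modulus (tau k) + modulus (sig k) <= W / 2 ^+ k.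
Proof.
move=> k2.
have LS : step_r k <= L.
  rewrite /step_r ler_pdivrMr ?exp2_gt0 // ler_peMr // exprn_ege1 // ler1n //.
have r0 : 0 <= step_r k by rewrite divr_ge0 ?exprn_ge0.
have -> : W / 2 ^+ k = 2 * expR L * step_r k + 2 * expR L * step_a k.
  by rewrite /W /step_r /step_a; ring.
apply: lerD; apply: div_le1; rewrite ?modulus_add1_ge1 ?Re_om // -polar00.
- apply: le_trans (polar_lipschitz 0 0 LS L0) _.
  by rewrite !subr0 normr0 addr0 ger0_norm.
- apply: le_trans (polar_lipschitz (step_a k) 0 L0 L0) _.
  by rewrite !subr0 normr0 add0r ger0_norm.
Qed.

(** Half a turn is [2 ^ (k - 1)] steps and takes 1 to -1, so these steps, each of length
    [|om k - 1|], cover a distance of at least 2. *)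
Let sig_ge k : (2 <= k)%N -> 1 <= modulus (sig k) * 2 ^+ k.
Proof.
case: k => // k k2.
have om1 : om k.+1 ^+ (2 ^ k) = -1.
  rewrite /om -polar_natmul mulr0 -polar_pi; congr polar.
  by rewrite /step_a natrX exprS; field; rewrite ?expf_neq0 // pnatr_eq0.
have oma : modulus (om k.+1) = 1 by rewrite /om modulus_polar expR0.
have := modulus_exp_sub1 (2 ^ k) oma.
rewrite om1 -opprD modulusN -(natrD _ 1 1) modulus_nat natrX => h.
have b2 : modulus (om k.+1 + 1) <= 2.
  by rewrite (le_trans (modulusD _ _)) // oma modulus1.
have b1 := modulus_add1_ge1 (Re_om k2).
rewrite /sig modulusM modulusV exprS.
have b0 : 0 < modulus (om k.+1 + 1) by exact: lt_le_trans b1.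
rewrite mulrAC ler_pdivlMr // mul1r (le_trans b2) //.
have -> : modulus (om k.+1 - 1) * (2 * 2 ^+ k) = 2 * (2 ^+ k * modulus (om k.+1 - 1)).
  by ring.
lra.
Qed.

(* By bisection: on a small cell [f] is affine up to [e'] times the diameter, and
   the contour sum is exact on affine functions. *)
Lemma goursat_contour (e : R) : 0 < e -> exists k0, forall k, (k0 <= k)%N ->
  modulus (contour (tau k) (sig k) (grid k) 0 0 (2 ^ k)) <= e.
Proof.
move=> e0.
(* Each of the [4 ^ l] cells of level [l] gets an equal share of [e]. Its contour is taken on the
   finer grid of level [k], and how fine that must be may depend on the cell. *)
pose P l a b := exists k0, forall k, (k0 + l <= k)%N ->
  modulus (contour (tau k) (sig k) (grid k) (a * 2 ^ (k - l)) (b * 2 ^ (k - l))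
    (2 ^ (k - l))) <= e / 4 ^+ l.
suff [k0 k0P] : P 0%N 0%N 0%N.
  exists k0 => k kk; have := k0P k; rewrite addn0 subn0 !mul0n expr0 divr1; exact.
apply: (@bisection R).
- move=> l a b [k1 P1] [k2 P2] [k3 P3] [k4 P4].
  exists (k1 + k2 + k3 + k4).+1 => k kk.
  have -> : (k - l = (k - l.+1).+1)%N by lia.
  set m := (2 ^ (k - l.+1))%N.
  have {}P1 := P1 k; have {}P2 := P2 k; have {}P3 := P3 k; have {}P4 := P4 k.
  rewrite -/m in P1 P2 P3 P4.
  have -> : (2 ^ (k - l.+1).+1 = m + m)%N by rewrite expnS -/m; lia.
  rewrite contour_split.
  have ea c : (c * (m + m) = 2 * c * m)%N by lia.
  have eb c : (2 * c * m + m = (2 * c).+1 * m)%N by lia.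
  rewrite !ea !eb.
  have -> : e / 4 ^+ l = e / 4 ^+ l.+1 + e / 4 ^+ l.+1 + e / 4 ^+ l.+1 + e / 4 ^+ l.+1.
    by rewrite exprS; field; rewrite expf_neq0 // pnatr_eq0.
  apply: le_trans (modulusD _ _) (lerD (le_trans (modulusD _ _) (lerD
    (le_trans (modulusD _ _) (lerD _ _)) _)) _).
  + by apply: P1; lia.
  + by apply: P2; lia.
  + by apply: P3; lia.
  + by apply: P4; lia.
- move=> x y.
  pose sx := s1 + L * x; pose ty := 2 * pi * y.
  pose p := polar sx ty.
  (* A bound for the logarithmic radii of all nodes of a cell containing [(x, y)], since its side is
     at most 1. *)
  pose S := s1 + L * (`|x| + 1).
  pose D := 2 * expR S * (L + 2 * pi).
  have D0 : 0 <= D by rewrite !mulr_ge0 ?expR_ge0 // addr_ge0 // mulr_ge0 // pi_ge0.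
  have [l fl] := (holo_cderiv f p).1 (fd (polar_neq0 _ _)).
  (* The cell has [4 * 2 ^ (k - m)] boundary edges, affine error at most [e' * D / 2 ^ m] at its
     nodes and weights at most [W / 2 ^ k]; the product must stay below [e / 4 ^ m]. *)
  pose e' := e / (4 * D * W + 1).
  have DW : 0 < 4 * D * W + 1.
    by rewrite ltr_wpDl // mulr_ge0 ?W_ge0 // mulr_ge0.
  have e'0 : 0 < e' by rewrite divr_gt0.
  have [d d0 dP] := fl _ e'0.
  have [l0 l0P] := @inv_exp2_small R (d / (D + 1)) (divr_gt0 d0 (ltr_wpDl D0 ltr01)).
  exists l0 => m a b lm xa yb; exists 2%N => k mk.
  have k2 : (2 <= k)%N by exact: leq_trans (leq_addr _ _) mk.
  have mk' : (m <= k)%N by exact: leq_trans (leq_addl _ _) mk.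
  have e2 : (2 ^+ k : R) = 2 ^+ m * 2 ^+ (k - m) by rewrite -exprD subnKC.
  have near_dy (u : R) c i : dyadic_in u m c -> (c * 2 ^ (k - m) <= i <= c * 2 ^ (k - m)
    + 2 ^ (k - m))%N ->
      `|i%:R / 2 ^+ k - u| <= (2 ^+ m)^-1.
    move=> /andP[u1 u2] /andP[i1 i2].
    have lo : c%:R / 2 ^+ m <= i%:R / 2 ^+ k :> R.
      rewrite ler_pdivlMr ?exp2_gt0 // e2 mulrA divfK ?gt_eqF ?exp2_gt0 //.
      by rewrite -natrX -natrM ler_nat.
    have hi : i%:R / 2 ^+ k <= c.+1%:R / 2 ^+ m :> R.
      rewrite ler_pdivrMr ?exp2_gt0 // e2 mulrA divfK ?gt_eqF ?exp2_gt0 //.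
      by rewrite -natrX -natrM ler_nat mulSn addnC.
    have : c.+1%:R / 2 ^+ m = c%:R / 2 ^+ m + (2 ^+ m)^-1 :> R.
      by rewrite -natr1 mulrDl mul1r.
    move=> ceq; rewrite ceq in hi u2.
    rewrite ler_norml; apply/andP; split; lra.
  pose err i j := grid k i j - (f p - l * p) - l * node k i j.
  have -> : grid k = fun i j => ((f p - l * p) + l * node k i j) + err i j.
    by apply/funext => i; apply/funext => j; rewrite /err; ring.
  rewrite (contourD _ _ _ err) (contourD _ _ (fun _ _ => _) (fun _ _ => _)).
  rewrite contour_cst contour_linear; first last.
  + move=> i j; rewrite nodeSa trapezoid_polar // -modulus_gt0.
    exact: lt_le_trans ltr01 (modulus_add1_ge1 (Re_om k2)).
  + move=> i j; rewrite nodeSr trapezoid_polar // -modulus_gt0.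
    exact: lt_le_trans ltr01 (modulus_add1_ge1 (Re_q _)).
  rewrite !add0r.
  apply: le_trans (@contour_bound _ _ _ _ _ _ _ (e' * (D / 2 ^+ m)) _) _.
    move=> i j ia jb; rewrite /err /grid.
    have dn : modulus (node k i j - p) <= D / 2 ^+ m.
      have hx := near_dy _ _ _ xa ia; have hy := near_dy _ _ _ yb jb.
      have im1 : (2 ^+ m)^-1 <= 1 :> R.
        by rewrite invf_le1 ?exp2_gt0 // exprn_ege1 // ler1n.
      have xx := ler_norm x.
      have ix : i%:R / 2 ^+ k <= `|x| + 1.
        by have := ler_norm (i%:R / 2 ^+ k - x); lra.
      have n1 : s1 + i%:R * step_r k <= S.
        rewrite lerD2l /step_r mulrCA ler_wpM2l //.
      have n2 : sx <= S by rewrite lerD2l ler_wpM2l // ler_wpDr.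
      apply: le_trans (polar_lipschitz _ _ n1 n2) _.
      rewrite /D -[leRHS]mulrA ler_wpM2l ?mulr_ge0 ?expR_ge0 // mulrDl.
      have -> : s1 + i%:R * step_r k - sx = L * (i%:R / 2 ^+ k - x).
        by rewrite /sx /step_r; ring.
      have -> : j%:R * step_a k - ty = 2 * pi * (j%:R / 2 ^+ k - y).
        by rewrite /ty /step_a; ring.
      have pi2 : 0 <= 2 * pi :> R by rewrite mulr_ge0 // pi_ge0.
      by rewrite !normrM (ger0_norm L0) -normrM (ger0_norm pi2) lerD // ler_wpM2l.
    have dd : modulus (node k i j - p) < d.
      apply: le_lt_trans dn _; apply: le_lt_trans (_ : (D + 1) * (2 ^+ m)^-1 < _).
        by rewrite ler_wpM2r ?invr_ge0 ?exprn_ge0 // lerDl.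
      by rewrite mulrC -ltr_pdivlMr ?l0P // ltr_wpDl.
    have -> : f (node k i j) - (f p - l * p) - l * node k i j =
      f (node k i j) - f p - l * (node k i j - p) by ring.
    apply: le_trans (dP _ dd) _; rewrite ler_wpM2l // ltW //.
  apply: le_trans (_ : 4 * (2 ^ (k - m))%:R * (e' * (D / 2 ^+ m)) * (W / 2 ^+ k) <= _).
    rewrite ler_wpM2l ?weights_le // mulr_ge0 // mulr_ge0 ?(ltW e'0) //.
    by rewrite divr_ge0 ?exprn_ge0.
  have -> : 4 * (2 ^ (k - m))%:R * (e' * (D / 2 ^+ m)) * (W / 2 ^+ k) =
      e * ((4 * D * W) / (4 * D * W + 1)) / 4 ^+ m.
    have -> : 4 ^+ m = 2 ^+ m * 2 ^+ m :> R by rewrite -exprMn -natrM.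
    rewrite e2 natrX /e'.
    by field; rewrite (gt_eqF DW) !gt_eqF ?exp2_gt0.
  rewrite ler_wpM2r ?invr_ge0 ?exprn_ge0 // ler_piMr ?ltW //.
  by rewrite ltr_pdivrMr // mul1r ltrDl.
Qed.

(** On the full annulus the radial sides coincide by periodicity, so the contour is [sig] times the
    difference of the circle sums, each node counted twice. The lower bound [sig_ge] allows division
    by [sig]. *)
Lemma circle_sums_close (e : R) : 0 < e -> exists2 k, (2 <= k)%N &
  modulus (\sum_(j < 2 ^ k) f (polar (s1 + L) (j%:R * (2 * pi / 2 ^+ k))) -
           \sum_(j < 2 ^ k) f (polar s1 (j%:R * (2 * pi / 2 ^+ k)))) <= e * 2 ^+ k.
Proof.
move=> e0; have [k0 k0P] := goursat_contour e0.
pose k := maxn 2 k0; have k2 : (2 <= k)%N by rewrite leq_maxl.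
exists k => //; have := k0P k (leq_maxr _ _).
have period i : node k i (2 ^ k) = node k i 0.
  have -> : node k i (2 ^ k) = node k i 0 * polar 0 ((2 ^ k)%:R * step_a k).
    by rewrite /node -polarD mul0r addr0 add0r.
  rewrite /step_a natrX.
  have -> : 2 ^+ k * (2 * pi / 2 ^+ k) = pi *+ 2 :> R.
    by rewrite mulrC divfK ?gt_eqF ?exp2_gt0 // mulr_natl.
  suff -> : polar 0 (pi *+ 2) = 1 :> C by rewrite mulr1.
  rewrite mulr2n -[0](addr0 0) polarD polar_pi; ring.
have sides i : vside (grid k) i 0 (2 ^ k) = 2 * \sum_(j < 2 ^ k) grid k i j.
  rewrite /vside big_split mulr2n mulrDl mul1r; congr (_ + _).
  rewrite -(big_mkord xpredT (fun j => grid k i (0 + j).+1)) -(big_mkord xpredT (grid k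
    i)) /=.
  have e2 : (2 ^ k = (2 ^ k).-1.+1)%N by rewrite prednK // expn_gt0.
  rewrite e2 big_nat_recr //= big_nat_recl //= addrC add0n -e2 /grid period.
  by congr (_ + _); apply: eq_bigr => j _; rewrite add0n.
have hs : hside (grid k) 0 (0 + 2 ^ k) (2 ^ k) = hside (grid k) 0 0 (2 ^ k).
  by apply: eq_bigr => j _; rewrite /grid add0n !period.
rewrite /contour hs subrr mulr0 add0r !sides -mulrBr mulrCA modulusM modulus_nat.
rewrite modulusM add0n.
have node0 j : grid k 0 j = f (polar s1 (j%:R * (2 * pi / 2 ^+ k))).
  by rewrite /grid /node mul0r addr0.
have node1 j : grid k (2 ^ k) j = f (polar (s1 + L) (j%:R * (2 * pi / 2 ^+ k))).
  rewrite /grid /node /step_r natrX; congr (f (polar (_ + _) _)).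
  by rewrite mulrC divfK // gt_eqF ?exp2_gt0.
under eq_bigr do rewrite node1.
under [X in modulus (_ - X)]eq_bigr do rewrite node0.
set A := modulus _; set B := modulus _ => h.
have h1 := sig_ge k2; have A0 : 0 <= B by exact: modulus_ge0.
have h2 := ler_wpM2r A0 h1.
have h3 := ler_wpM2r (exprn_ge0 k (ler0n R 2)) h.
rewrite -/A in h1 h2 h3.
have A1 : 0 <= A * B * 2 ^+ k by rewrite !mulr_ge0 ?exprn_ge0 //; exact: modulus_ge0.
have h4 : A * 2 ^+ k * B = A * B * 2 ^+ k by ring.
have h5 : 2 * (A * B) * 2 ^+ k = 2 * (A * B * 2 ^+ k) by ring.
rewrite h4 in h2; rewrite h5 in h3; lra.
Qed.

End Goursat.

(** * Holomorphic functions and the mean inequality *)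

Section Holomorphy.
Variable R : realType.
Local Notation C := R[i].
Implicit Types (f g : C -> C) (z w : C).

Lemma ccont_cst c z : ccont (fun=> c) z.
Proof. by move=> e e0; exists 1 => // w _; rewrite subrr modulus0. Qed.

Lemma ccontM f g z : ccont f z -> ccont g z -> ccont (fun w => f w * g w) z.
Proof.
move=> /ccontP fz /ccontP gz; apply/ccontP.
exact: (@continuousM C C^o _ _ _ fz gz).
Qed.

Lemma ccontX f k z : ccont f z -> ccont (fun w => f w ^+ k) z.
Proof.
move=> fz; elim: k => [|k IH]; first exact: ccont_cst.
have -> : (fun w => f w ^+ k.+1) = (fun w => f w * f w ^+ k).
  by apply/funext => w; rewrite exprS.
exact: ccontM.
Qed.

Lemma holo_cst c z : holo (fun=> c) z.
Proof. exact: derivable_cst. Qed.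

Lemma holo_id z : holo id z.
Proof. exact: derivable_id. Qed.

Lemma holoD f g z : holo f z -> holo g z -> holo (fun w => f w + g w) z.
Proof. exact: derivableD. Qed.

Lemma holoB f g z : holo f z -> holo g z -> holo (fun w => f w - g w) z.
Proof. exact: derivableB. Qed.

Lemma holoM f g z : holo f z -> holo g z -> holo (fun w => f w * g w) z.
Proof. exact: derivableM. Qed.

Lemma holoV f z : f z != 0 -> holo f z -> holo (fun w => (f w)^-1) z.
Proof. exact: derivableV. Qed.

Lemma holoX f k z : holo f z -> holo (fun w => f w ^+ k) z.
Proof.
move=> fz; elim: k => [|k IH]; first exact: holo_cst.
have -> : (fun w => f w ^+ k.+1) = (fun w => f w * f w ^+ k).
  by apply/funext => w; rewrite exprS.
exact: holoM.
Qed.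

Lemma holo_near f g z d : 0 < d ->
  (forall w, modulus (w - z) < d -> f w = g w) -> holo f z -> holo g z.
Proof.
move=> d0 fg /holo_cderiv[l fl]; apply/holo_cderiv; exists l => e e0.
have [d' d'0 dP] := fl _ e0; exists (Num.min d d'); first by rewrite lt_min d0.
move=> w; rewrite lt_min => /andP[h1 h2].
by rewrite -!fg ?dP // subrr modulus0.
Qed.

Lemma eq_holo f g z : f =1 g -> holo f z -> holo g z.
Proof. by move=> /funext ->. Qed.

Lemma holo_shift f z c : holo f (z + c) -> holo (fun w => f (w + c)) z.
Proof.
move=> /holo_cderiv[l fl]; apply/holo_cderiv; exists l => e /fl[d d0 dP].
exists d => // w wz; have := dP (w + c).
by rewrite opprD addrACA subrr addr0; exact.
Qed.

(** The difference quotient at [z] is [f] itself, so continuity of [f] suffices. *)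
Lemma holo_vanish f z : ccont f z -> holo (fun w => (w - z) * f w) z.
Proof.
move=> fz; apply/holo_cderiv; exists (f z) => e /fz[d d0 dP].
exists d => // w /dP wz.
have -> : (w - z) * f w - (z - z) * f z - f z * (w - z) = (f w - f z) * (w - z).
  by ring.
by rewrite modulusM ler_wpM2r ?modulus_ge0 // ltW.
Qed.

Lemma ccont_bounded f (rho : R) : 0 < rho -> (forall z, ccont f z) ->
  exists M, forall z, modulus z <= rho -> modulus (f z) <= M.
Proof.
move=> rho0 fc.
(* Maps the unit square of [bisection] onto the square of half side [rho], which contains the
   disc. *)
pose Z (x y : R) : C := (rho * (2 * x - 1)) +i* (rho * (2 * y - 1)).
pose P l a b := exists M, forall x y : R, dyadic_in x l a -> dyadic_in y l b ->
  modulus (f (Z x y)) <= M.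
suff [M MP] : P 0%N 0%N 0%N.
  exists M => z zr.
  have unit (u : R) : `|u| <= rho -> dyadic_in ((u / rho + 1) / 2) 0 0.
    rewrite ler_norml /dyadic_in expr0 !divr1 => /andP[u1 u2].
    have h1 : -1 <= u / rho by rewrite ler_pdivlMr // mulN1r.
    have h2 : u / rho <= 1 by rewrite ler_pdivrMr // mul1r.
    by apply/andP; split; lra.
  have := MP _ _ (unit _ (le_trans (Re_le_modulus z) zr))
    (unit _ (le_trans (Im_le_modulus z) zr)).
  suff -> : Z ((complex.Re z / rho + 1) / 2) ((complex.Im z / rho + 1) / 2) = z by [].
  apply/eqP; rewrite eq_complex /=; apply/andP; split; apply/eqP; field;
    by rewrite gt_eqF.
apply: (@bisection R).
- move=> l a b [M1 P1] [M2 P2] [M3 P3] [M4 P4].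
  have half (x : R) c : dyadic_in x l c ->
      dyadic_in x l.+1 (2 * c)%N \/ dyadic_in x l.+1 (2 * c).+1.
    have e1 m : (2 * m)%:R / 2 ^+ l.+1 = m%:R / 2 ^+ l :> R.
      by rewrite natrM exprS -mulf_div divff ?mul1r.
    rewrite /dyadic_in => /andP[x1 x2].
    have -> : (2 * c).+2 = (2 * c.+1)%N by lia.
    rewrite !e1 x1 x2 andbT /=.
    by case: (leP x ((2 * c).+1%:R / 2 ^+ l.+1)) => [h|/ltW h]; [left|right].
  exists (`|M1| + `|M2| + `|M3| + `|M4|) => x y /half hx /half hy.
  have := normr_ge0 M1; have := normr_ge0 M2; have := normr_ge0 M3.
  have := normr_ge0 M4; have := ler_norm M1; have := ler_norm M2.
  have := ler_norm M3; have := ler_norm M4.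
  by move: hx hy => [hx|hx] [hy|hy]; [have := P1 _ _ hx hy|have := P3 _ _ hx hy|
    have := P2 _ _ hx hy|have := P4 _ _ hx hy]; move: (modulus _) => m; lra.
- move=> x y; have [d d0 dP] := fc (Z x y) _ ltr01.
  have [l0 l0P] := @inv_exp2_small R (d / (4 * rho)) (divr_gt0 d0 (mulr_gt0 (ltr0n _ 4)
    rho0)).
  exists l0 => l a b /l0P ll xa yb; exists (1 + modulus (f (Z x y))) => x' y' xa' yb'.
  have close (u v : R) c : dyadic_in u l c -> dyadic_in v l c ->
      `|rho * (2 * u - 1) - rho * (2 * v - 1)| < d / 2.
    move=> /andP[u1 u2] /andP[v1 v2].
    have e : c.+1%:R / 2 ^+ l = c%:R / 2 ^+ l + (2 ^+ l)^-1 :> R.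
      by rewrite -natr1 mulrDl mul1r.
    have -> : rho * (2 * u - 1) - rho * (2 * v - 1) = (2 * rho) * (u - v) by ring.
    have r20 : 0 < 2 * rho by rewrite mulr_gt0.
    have -> : d / 2 = (2 * rho) * (d / (4 * rho)) by field; rewrite gt_eqF.
    rewrite normrM (gtr0_norm r20) ltr_pM2l //; apply: le_lt_trans ll.
    rewrite e in u2 v2; rewrite ler_norml; apply/andP; split; lra.
  have := dP (Z x' y'); rewrite -lerBlDr => h; apply: le_trans (modulusB_ge _ _) _.
  apply/ltW/h; apply: le_lt_trans (modulus_Re_Im _) _ => /=.
  by rewrite (splitr d) ltrD // ?(close _ _ _ xa' xa) ?(close _ _ _ yb' yb).
Qed.

(** The average over the circle of radius [r] nearly equals that over a small circle, which is
    nearly [f z0] by continuity. All circles avoid [z0], so differentiability there is not called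
    for. *)
Lemma mean_inequality f z0 (r S : R) : 0 < r -> ccont f z0 ->
  (forall z, z != z0 -> holo f z) ->
  (forall z, modulus (z - z0) = r -> modulus (f z) <= S) ->
  modulus (f z0) <= S.
Proof.
move=> r0 fc fh fS; apply/ler_addgt0Pr => e e0.
have e2 : 0 < e / 2 by rewrite divr_gt0.
have [d d0 dP] := fc _ e2.
pose r1 := Num.min r (d / 2).
have r10 : 0 < r1 by rewrite lt_min r0 divr_gt0.
have r1r : r1 <= r by rewrite ge_min lexx.
have r1d : r1 < d by rewrite gt_min ltr_pdivrMr // mulr_natr mulr2n ltrDl d0 orbT.
have L0 : 0 <= ln r - ln r1 by rewrite subr_ge0 ler_ln.
have fh' z : z != 0 -> holo (fun w => f (w + z0)) z.
  by move=> z0'; apply: holo_shift; apply: fh; rewrite -subr_eq0 addrK.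
have [k k2] := circle_sums_close (ln r1) L0 fh' e2.
have -> : ln r1 + (ln r - ln r1) = ln r by rewrite addrCA subrr addr0.
set A := \sum_(_ < _) _; set B := \sum_(_ < _) _ => AB.
have AS : modulus A <= 2 ^+ k * S.
  apply: le_trans (modulus_sum _ _ _) _.
  apply: (@le_trans _ _ (\sum_(i < 2 ^ k) S)); last first.
    by rewrite sumr_const card_ord -[leLHS]mulr_natl natrX.
  by apply: ler_sum => i _; apply: fS; rewrite addrK modulus_polar lnK.
have BS : modulus (2 ^+ k * f z0 - B) <= 2 ^+ k * (e / 2).
  have -> : 2 ^+ k * f z0 = \sum_(i < 2 ^ k) f z0.
    by rewrite sumr_const card_ord -[RHS]mulr_natl natrX.
  rewrite -sumrB; apply: le_trans (modulus_sum _ _ _) _.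
  apply: (@le_trans _ _ (\sum_(i < 2 ^ k) (e / 2))); last first.
    by rewrite sumr_const card_ord -[leLHS]mulr_natl natrX.
  apply: ler_sum => i _; rewrite modulusBC; apply/ltW/dP.
  by rewrite addrK modulus_polar lnK.
rewrite -(ler_pM2l (exp2_gt0 R k)).
have -> : 2 ^+ k * modulus (f z0) = modulus (2 ^+ k * f z0).
  by rewrite modulusM modulusX modulus_nat.
have -> : 2 ^+ k * f z0 = (2 ^+ k * f z0 - B) + (B - A) + A by ring.
have := modulusD ((2 ^+ k * f z0 - B) + (B - A)) A.
have := modulusD (2 ^+ k * f z0 - B) (B - A).
rewrite (modulusBC B A).
have -> : 2 ^+ k * (S + e) = 2 ^+ k * S + 2 ^+ k * (e / 2) + e / 2 * 2 ^+ k by field.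
move=> h1 h2; apply: le_trans h2 _; rewrite -[leRHS]addrA [leLHS]addrC lerD //.
by apply: le_trans h1 _; rewrite lerD.
Qed.

Lemma expr_unbounded (q B : R) : 1 < q -> exists k, B < q ^+ k.
Proof.
move=> q1; have q0 : 0 < q - 1 by rewrite subr_gt0.
have bern k : 1 + k%:R * (q - 1) <= q ^+ k.
  elim: k => [|k IH]; first by rewrite mul0r addr0 expr0.
  rewrite exprS; apply: le_trans (_ : q * (1 + k%:R * (q - 1)) <= _).
    have := mulr_ge0 (ler0n R k) (sqr_ge0 (q - 1)).
    rewrite -natr1; set x := k%:R; nra.
  by rewrite ler_wpM2l // ltW // (lt_trans ltr01).
exists (Num.trunc (B / (q - 1))).+1; apply: lt_le_trans (bern _).
have := Num.Theory.truncnS_gt (B / (q - 1)); rewrite ltr_pdivrMr // => h.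
by rewrite (lt_trans h) // ltrDr.
Qed.

(** Taking [k]-th roots removes the constant [B]: for [T] strictly between [S] and [x], the powers
    of [x / T] would exceed it. *)
Lemma le_of_expr_le (x S B : R) : 0 <= x -> 0 <= S -> 0 <= B ->
  (forall k, x ^+ k <= B * S ^+ k) -> x <= S.
Proof.
move=> x0 S0 B0 h; rewrite leNgt; apply/negP => Sx.
pose T := (S + x) / 2; have ST : S < T by rewrite /T; lra.
have Tx : T < x by rewrite /T; lra.
have T0 : 0 < T by exact: le_lt_trans ST.
have q1 : 1 < x / T by rewrite ltr_pdivlMr // mul1r.
have [k] := expr_unbounded B q1; rewrite expr_div_n ltr_pdivlMr ?exprn_gt0 //.
apply/negP; rewrite -leNgt; apply: le_trans (h k) _.
by rewrite ler_wpM2l // lerXn2r ?nnegrE // ltW.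
Qed.

(* Multiplying the [k]-th power of [f] by a fixed polynomial vanishing at the
   exceptional points makes it holomorphic there; then [k] tends to infinity. *)
Lemma mean_inequality_except f z0 (ws : seq C) (r S : R) : 0 < r ->
  (forall z, ccont f z) -> z0 \notin ws ->
  (forall z, z != z0 -> z \notin ws -> holo f z) ->
  (forall z, modulus (z - z0) = r -> modulus (f z) <= S) ->
  modulus (f z0) <= S.
Proof.
move=> r0 fc z0ws fh fS.
pose Q z := \prod_(w <- ws) (z - w).
have hQ z : holo Q z.
  rewrite /Q; elim: (ws) => [|w s IH].
    by apply: eq_holo _ (@holo_cst 1 z) => w; rewrite big_nil.
  apply: eq_holo _ (holoM (holoB (@holo_id z) (@holo_cst w z)) IH) => v.
  by rewrite big_cons.
have S0 : 0 <= S.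
  apply: le_trans (modulus_ge0 (f (z0 + r%:C))) (fS _ _).
  by rewrite addrAC subrr add0r modulus_real gtr0_norm.
have [B BP] : exists B, forall z, modulus (z - z0) = r -> modulus (Q z) <= B.
  have r1 : 0 < r + modulus z0 by rewrite ltr_wpDr ?modulus_ge0.
  have [B BP] := ccont_bounded r1 (fun z => holo_ccont (hQ z)).
  exists B => z zr; apply: BP; rewrite -{1}(subrK z0 z).
  by rewrite (le_trans (modulusD _ _)) // zr.
have B0 : 0 <= B.
  apply: le_trans (modulus_ge0 (Q (z0 + r%:C))) (BP _ _).
  by rewrite addrAC subrr add0r modulus_real gtr0_norm.
have Q0 : 0 < modulus (Q z0).
  rewrite modulus_gt0 /Q prodf_seq_neq0; apply/allP => w wws /=.
  by rewrite subr_eq0; apply: contraNneq z0ws => ->.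
apply: (@le_of_expr_le _ _ (B / modulus (Q z0))); rewrite ?modulus_ge0 //.
  by rewrite divr_ge0 ?modulus_ge0.
move=> k; rewrite mulrAC ler_pdivlMr // -modulusX -modulusM mulrC.
apply: (@mean_inequality (fun z => Q z * f z ^+ k) z0 r) => //.
- by apply: ccontM (ccontX _ (fc _)); apply: holo_ccont.
- move=> z zz0; have [zws|] := boolP (z \in ws); last first.
    by move=> zws; apply: holoM => //; apply: holoX; apply: fh.
  (* One factor [v - z] of [Q] is enough to make the product differentiable at [z]. *)
  have [s sP] : exists s, forall v, Q v = (v - z) * \prod_(w <- s) (v - w).
    exists (rem z ws) => v.
    by rewrite /Q (perm_big _ (perm_to_rem zws)) big_cons.
  have hs : ccont (fun v => \prod_(w <- s) (v - w)) z.
    elim: (s) => [|w t IH].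
      by apply: holo_ccont; apply: eq_holo _ (@holo_cst 1 z) => w; rewrite big_nil.
    have -> : (fun v : C => \prod_(j <- (w :: t)) (v - j)) =
        (fun v => (v - w) * \prod_(j <- t) (v - j)).
      by apply/funext => v; rewrite big_cons.
    exact: ccontM (holo_ccont (holoB (@holo_id z) (@holo_cst w z))) IH.
  apply: eq_holo _ (holo_vanish (ccontM hs (ccontX k (fc z)))) => v.
  by rewrite sP mulrA.
- move=> z zr; rewrite modulusM modulusX ler_pM ?modulus_ge0 ?exprn_ge0 ?modulus_ge0 ?BP //.
  by rewrite lerXn2r ?nnegrE ?modulus_ge0 ?fS.
Qed.

End Holomorphy.

(** * Removable singularities and Taylor expansion *)

Section DividedDifference.
Variable R : realType.
Local Notation C := R[i].
Implicit Types (f g : C -> C) (z w l : C).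

(** The value [l] fills the gap at [w]; continuity there requires it to be the derivative of [f]. *)
Definition divided_difference f w l z := if z == w then l else (f z - f w) / (z - w).

Lemma ccont_near f g z d : 0 < d ->
  (forall w, modulus (w - z) < d -> f w = g w) -> ccont f z -> ccont g z.
Proof.
move=> d0 fg fz e /fz[d' d'0 dP]; exists (Num.min d d'); first by rewrite lt_min d0.
move=> w; rewrite lt_min => /andP[h1 h2].
by rewrite -!fg ?dP // subrr modulus0.
Qed.

Lemma neq_near z w : z != w ->
  forall v, modulus (v - z) < modulus (z - w) -> v != w.
Proof. by move=> zw v; apply: contraTneq => ->; rewrite modulusBC ltxx. Qed.

Lemma ccontB_cst f z w : ccont f z -> ccont (fun v => f v - w) z.
Proof.
move=> fz e /fz[d d0 dP]; exists d => // v /dP.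
by rewrite opprB addrA subrK.
Qed.

Lemma holo_invB z w : z != w -> holo (fun v => (v - w)^-1) z.
Proof.
move=> zw; apply: holoV; first by rewrite subr_eq0.
exact: holoB (@holo_id _ z) (@holo_cst _ w z).
Qed.

Lemma divided_difference_near f w l z : z != w ->
  forall v, modulus (v - z) < modulus (z - w) ->
    (f v - f w) * (v - w)^-1 = divided_difference f w l v.
Proof. by move=> zw v /(neq_near zw) vw; rewrite /divided_difference (negPf vw). Qed.

Lemma divided_difference_holo f w l z : z != w -> holo f z ->
  holo (divided_difference f w l) z.
Proof.
move=> zw fz; apply: holo_near (divided_difference_near f l zw) _.
  by rewrite modulus_gt0 subr_eq0.
exact: holoM (holoB fz (@holo_cst _ _ _)) (holo_invB zw).
Qed.

Lemma divided_difference_ccont f w l z : ccont f z -> cderiv f w l ->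
  ccont (divided_difference f w l) z.
Proof.
move=> fz fw; have [->|zw] := eqVneq z w; last first.
  apply: ccont_near (divided_difference_near f l zw) _.
    by rewrite modulus_gt0 subr_eq0.
  exact: ccontM (ccontB_cst _ fz) (holo_ccont (holo_invB zw)).
move=> e e0; have e2 : 0 < e / 2 by rewrite divr_gt0.
have [d d0 dP] := fw _ e2.
exists d => // v vd; rewrite /divided_difference eqxx.
have [_|vw] := eqVneq v w; first by rewrite subrr modulus0.
have vw0 : v - w != 0 by rewrite subr_eq0.
have -> : (f v - f w) / (v - w) - l = (f v - f w - l * (v - w)) / (v - w) by field.
rewrite modulusM modulusV ltr_pdivrMr ?modulus_gt0 //.
apply: le_lt_trans (dP _ vd) _.
by rewrite ltr_pM2r ?modulus_gt0 // ltr_pdivrMr // mulr_natr mulr2n ltrDl.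
Qed.

Lemma divided_difference_bound f w l z (B : R) : modulus (f z) <= B ->
  modulus (f w) <= B -> 2^-1 <= modulus (z - w) ->
  modulus (divided_difference f w l z) <= 4 * B.
Proof.
move=> fz fw zw; have B0 : 0 <= B by exact: le_trans (modulus_ge0 _) fz.
have zw0 : 0 < modulus (z - w) by rewrite (lt_le_trans _ zw) // invr_gt0.
rewrite /divided_difference -subr_eq0 -modulus_eq0 gt_eqF //.
rewrite modulusM modulusV ler_pdivrMr //.
apply: le_trans (modulusB _ _) _; apply: le_trans (lerD fz fw) _.
have := ler_wpM2l (mulr_ge0 (ler0n R 4) B0) zw; lra.
Qed.

(** Completeness with a rate: every [phi v - B * modulus v] lies below every
    [phi w + B * modulus w], so the supremum of the former is the limit. *)
Lemma punctured_limit (phi : C -> R) (B d : R) : 0 < d -> 0 <= B ->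
  (forall v w, v != 0 -> w != 0 -> modulus v < d -> modulus w < d ->
     `|phi v - phi w| <= B * (modulus v + modulus w)) ->
  exists l : R, forall v, v != 0 -> modulus v < d -> `|phi v - l| <= B * modulus v.
Proof.
move=> d0 B0 h.
pose A := [set phi v - B * modulus v | v in [set v | v != 0 /\ modulus v < d]]%classic.
have ub v : v != 0 -> modulus v < d -> ubound A (phi v + B * modulus v).
  move=> v0 vd _ [w [w0 wd] <-].
  by have := h _ _ v0 w0 vd wd; rewrite mulrDr ler_norml => /andP[+ _]; lra.
pose v0 : C := (d / 2)%:C.
have v0n : v0 != 0 by rewrite -modulus_gt0 modulus_real normr_gt0 gt_eqF // divr_gt0.
have v0d : modulus v0 < d.
  by rewrite modulus_real gtr0_norm ?divr_gt0 // ltr_pdivrMr // mulr_natr mulr2n ltrDl.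
have A0 : (A !=set0)%classic by exists (phi v0 - B * modulus v0), v0.
exists (sup A) => v vn vd.
have h1 : phi v - B * modulus v <= sup A.
  apply: ub_le_sup; last by exists v.
  by exists (phi v0 + B * modulus v0); exact: ub.
have h2 : sup A <= phi v + B * modulus v by apply: ge_sup => //; exact: ub.
by rewrite ler_norml; apply/andP; split; lra.
Qed.

(* The second divided differences of [f] are bounded near [0] by the mean
   inequality, so the first ones form a Cauchy family there. *)
Lemma removable_singularity f : (forall z, ccont f z) ->
  (forall z, z != 0 -> holo f z) -> holo f 0.
Proof.
move=> fc fh.
have [M fM] := ccont_bounded (ltr0n R 2) fc.
have M0 : 0 <= M by apply: le_trans (modulus_ge0 (f 0)) (fM _ _); rewrite modulus0.
pose h w := (f w - f 0) / w.
(* The left side is [v] times the second divided difference [K] at [0]. With all points within 1/4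
   of [0], the circles of radius 1 stay at distance at least 1/2 from the nodes, so each division
   costs a factor 4. *)
have key v w : v != 0 -> w != 0 -> v != w -> modulus v < 4^-1 -> modulus w < 4^-1 ->
    modulus (h w - (f v - f w) / (v - w)) <= 16 * M * modulus v.
  move=> v0 w0 vw v4 w4; have wv : w != v by rewrite eq_sym.
  have [l fl] := (holo_cderiv f w).1 (fh w w0).
  pose H := divided_difference f w l.
  have Hc z : ccont H z by exact: divided_difference_ccont.
  have Hh z : z != 0 -> z != w -> holo H z.
    by move=> z0 zw; apply: divided_difference_holo => //; exact: fh.
  have f4 z : modulus z <= 3/2 -> modulus (f z) <= M.
    by move=> z2; apply: fM; apply: le_trans z2 _; lra.
  have Hv : modulus (H v) <= 4 * M.
    apply: (@mean_inequality_except R H v [:: 0; w] 1) => //.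
    - by rewrite !inE negb_or v0.
    - by move=> z _; rewrite !inE negb_or => /andP[z0 zw]; exact: Hh.
    - move=> z z1; have z5 : modulus z <= 1 + 4^-1.
        by rewrite -(subrK v z) (le_trans (modulusD _ _)) // z1 lerD2l ltW.
      apply: divided_difference_bound; rewrite ?f4 //; try lra.
      have -> : z - w = (z - v) + (v - w) by ring.
      apply: le_trans (modulusD_ge _ _); rewrite z1.
      have := modulusB v w; lra.
  have [m Hm] := (holo_cderiv H v).1 (Hh v v0 vw).
  pose K := divided_difference H v m.
  have K0 : modulus (K 0) <= 4 * (4 * M).
    apply: (@mean_inequality_except R K 0 [:: w; v] 1) => //.
    - by move=> z; exact: divided_difference_ccont.
    - by rewrite !inE negb_or ![0 == _]eq_sym w0.
    - move=> z z0; rewrite !inE negb_or => /andP[zw zv].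
      by apply: divided_difference_holo => //; exact: Hh.
    - move=> z; rewrite subr0 => z1.
      apply: divided_difference_bound => //; last first.
        by apply: le_trans (modulusB_ge _ _); rewrite z1; lra.
      apply: divided_difference_bound; rewrite ?f4 //; try lra.
      by apply: le_trans (modulusB_ge _ _); rewrite z1; lra.
  move: K0; rewrite /K /divided_difference eq_sym (negPf v0).
  rewrite {1 2}/H /divided_difference [0 == w]eq_sym (negPf w0) (negPf vw).
  rewrite modulusM modulusV [0 - v]sub0r modulusN ler_pdivrMr ?modulus_gt0 // [0 -
    w]sub0r mulrA -natrM.
  apply: le_trans; rewrite le_eqVlt; apply/orP; left; apply/eqP; congr modulus.
  by rewrite /h; congr (_ - _); rewrite invrN mulrN -mulNr opprB.
have cauchy v w : v != 0 -> w != 0 -> modulus v < 4^-1 -> modulus w < 4^-1 ->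
    modulus (h v - h w) <= 16 * M * (modulus v + modulus w).
  move=> v0 w0 v4 w4; have [->|vw] := eqVneq v w.
    by rewrite subrr modulus0 !mulr_ge0 // addr_ge0 ?modulus_ge0.
  have wv : w != v by rewrite eq_sym.
  (* The quotient between [v] and [w] is symmetric, so it is close to both [h v] and [h w]. *)
  have -> : h v - h w = (h v - (f w - f v) / (w - v)) - (h w - (f v - f w) / (v - w)).
    have -> : (f w - f v) / (w - v) = (f v - f w) / (v - w).
      by rewrite -(opprB v w) invrN mulrN -mulNr opprB.
    by ring.
  rewrite mulrDr [leRHS]addrC; apply: le_trans (modulusB _ _) _.
  by rewrite lerD // key.
have q0 : 0 < 4^-1 :> R by rewrite invr_gt0.
have M16 : 0 <= 16 * M by rewrite mulr_ge0.
have ReB (z z' : C) : complex.Re z - complex.Re z' = complex.Re (z - z').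
  by case: z z' => ? ? [].
have ImB (z z' : C) : complex.Im z - complex.Im z' = complex.Im (z - z').
  by case: z z' => ? ? [].
have [a aP] : exists l : R, forall v, v != 0 -> modulus v < 4^-1 ->
    `|complex.Re (h v) - l| <= 16 * M * modulus v.
  apply: punctured_limit => // v w v0 w0 vd wd; rewrite ReB.
  exact: le_trans (Re_le_modulus _) (cauchy _ _ v0 w0 vd wd).
have [b bP] : exists l : R, forall v, v != 0 -> modulus v < 4^-1 ->
    `|complex.Im (h v) - l| <= 16 * M * modulus v.
  apply: punctured_limit => // v w v0 w0 vd wd; rewrite ImB.
  exact: le_trans (Im_le_modulus _) (cauchy _ _ v0 w0 vd wd).
apply/holo_cderiv; exists (a +i* b) => e e0.
exists (Num.min 4^-1 (e / (32 * M + 1))).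
  by rewrite lt_min q0 divr_gt0 // ltr_wpDl // mulr_ge0.
move=> w; rewrite subr0 lt_min => /andP[w4 we].
have [->|w0] := eqVneq w 0; first by rewrite subrr mulr0 subr0 modulus0 mulr0.
have -> : f w - f 0 - (a +i* b) * w = (h w - (a +i* b)) * w.
  by rewrite /h mulrBl divfK.
rewrite modulusM ler_wpM2r ?modulus_ge0 //.
apply: le_trans (modulus_Re_Im _) _.
rewrite -ReB -ImB /=; apply: le_trans (lerD (aP _ w0 w4) (bP _ w0 w4)) _.
move: we; rewrite ltr_pdivlMr ?ltr_wpDl // ?mulr_ge0 // => we.
have := modulus_ge0 w; have -> : 16 * M * modulus w + 16 * M * modulus w = modulus w *
  (32 * M).
  by ring.
by move: we; rewrite mulrDr mulr1; lra.
Qed.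

End DividedDifference.

(** * Taylor expansion of entire functions *)

Section Taylor.
Variable R : realType.
Local Notation C := R[i].
Implicit Types (f g : C -> C).

Lemma entire_quotient f : entire f ->
  exists g, entire g /\ forall z, f z = f 0 + z * g z.
Proof.
move=> fe; have [l fl] := (holo_cderiv f 0).1 (fe 0).
exists (divided_difference f 0 l); split; last first.
  move=> z; rewrite /divided_difference subr0; have [->|z0] := eqVneq z 0.
    by rewrite mul0r addr0.
  by rewrite mulrC divfK // addrC subrK.
have gh z : z != 0 -> holo (divided_difference f 0 l) z.
  by move=> z0; apply: divided_difference_holo => //; exact: fe.
move=> z; have [->|] := eqVneq z 0; last exact: gh.
apply: removable_singularity gh => w.
by apply: divided_difference_ccont => //; exact: holo_ccont (fe w).
Qed.

Lemma entire_bounded f (r : R) : entire f ->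
  exists M, forall z, modulus z <= r -> modulus (f z) <= M.
Proof.
move=> fe; have r0 : 0 < `|r| + 1 by rewrite ltr_wpDl.
have [M MP] := ccont_bounded r0 (fun z => holo_ccont (fe z)).
exists M => z zr; apply: MP; have := ler_norm r; lra.
Qed.

Lemma entire_mean f z0 (r S : R) : entire f -> 0 < r ->
  (forall z, modulus (z - z0) = r -> modulus (f z) <= S) -> modulus (f z0) <= S.
Proof.
move=> fe r0 fS; apply: mean_inequality fS => // [|z _]; last exact: fe.
exact: holo_ccont (fe z0).
Qed.

Lemma entire_horner (p : {poly C}) : entire (horner p).
Proof.
elim/poly_ind: p => [|p c IH] z.
  by apply: eq_holo _ (@holo_cst _ 0 z) => w; rewrite horner0.
apply: eq_holo _ (holoD (holoM (IH z) (@holo_id _ z)) (@holo_cst _ c z)) => w.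
by rewrite !hornerE.
Qed.

(* The factors [2 ^+ m] and [4] are what iterating the quotient by [z] costs; any
   geometric loss is harmless for growth orders. *)
Lemma taylor_expansion f : entire f -> exists c : nat -> C,
  (forall (r M : R) m, 0 < r -> (forall z, modulus z = r -> modulus (f z) <= M) ->
     modulus (c m) <= M * (2 / r) ^+ m) /\
  (forall (r M : R) k w, 0 < r -> (forall z, modulus z <= 4 * r -> modulus (f z) <= M) ->
     modulus w <= r ->
     modulus (f w - \sum_(m < k) c m * w ^+ m) <= M * (modulus w / r) ^+ k).
Proof.
move=> fe.
have /choice[Q QP] : forall g, exists g', entire g ->
    entire g' /\ forall z, g z = g 0 + z * g' z.
  move=> g; have [ge|nge] := pselect (entire g); last by exists g.
  by have [g' g'P] := entire_quotient ge; exists g'.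
pose g k := iter k Q f; pose c k := g k 0.
have ge k : entire (g k) by elim: k => [|k /QP[ge _]]; [exact: fe|exact: ge].
have gS k z : g k z = c k + z * g k.+1 z by have [_ ->] := QP _ (ge k).
have gT k z : f z = \sum_(m < k) c m * z ^+ m + z ^+ k * g k z.
  elim: k => [|k IH]; first by rewrite big_ord0 add0r expr0 mul1r.
  rewrite big_ord_recr /= {1}IH (gS k z) exprSr.
  by rewrite mulrDr addrA [_ * c k]mulrC mulrA.
(* On the circle [z * g k.+1 z = g k z - c k], and the mean inequality bounds [c k] by the maximum
   of [g k]; hence a factor 2 per step. *)
have gB (r M : R) k : 0 < r -> (forall z, modulus z = r -> modulus (f z) <= M) ->
    forall z, modulus z = r -> modulus (g k z) <= M * (2 / r) ^+ k.
  move=> r0 fM; elim: k => [|k IH] z zr; first by rewrite expr0 mulr1 fM.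
  have ck : modulus (c k) <= M * (2 / r) ^+ k.
    by apply: (entire_mean (ge k) r0) => w; rewrite subr0; exact: IH.
  have -> : M * (2 / r) ^+ k.+1 = M * (2 / r) ^+ k * 2 / r by rewrite exprSr !mulrA.
  rewrite ler_pdivlMr // -{1}zr mulrC -modulusM.
  have -> : z * g k.+1 z = g k z - c k by rewrite (gS k z) addrAC subrr add0r.
  apply: le_trans (modulusB _ _) _.
  by rewrite mulr_natr mulr2n lerD // IH.
exists c; split=> [r M m r0 fM|r M k w r0 fM wr].
  by apply: (entire_mean (ge m) r0) => w; rewrite subr0; exact: gB.
rewrite (gT k w) addrAC subrr add0r modulusM modulusX expr_div_n mulrCA.
rewrite ler_wpM2l ?exprn_ge0 ?modulus_ge0 //.
(* The circle of radius [3 * r] around [w] lies in [2 * r <= modulus z <= 4 * r], where the factor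
   [(2 / modulus z) ^ k] is at most [r ^- k]. *)
have r3 : 0 < 3 * r by rewrite mulr_gt0.
have M0 : 0 <= M.
  by apply: le_trans (modulus_ge0 (f 0)) (fM _ _); rewrite modulus0 mulr_ge0 // ltW.
apply: (entire_mean (ge k) r3) => z zw.
have z2 : 2 * r <= modulus z.
  by rewrite -(subrK w z); apply: le_trans (modulusD_ge _ _); rewrite zw; lra.
have z4 : modulus z <= 4 * r.
  by rewrite -(subrK w z); apply: le_trans (modulusD _ _) _; rewrite zw; lra.
have z0 : 0 < modulus z by apply: lt_le_trans z2; rewrite mulr_gt0.
apply: le_trans (gB (modulus z) M k z0 _ z erefl) _.
  by move=> v vz; apply: fM; rewrite vz.
rewrite ler_wpM2l // -exprVn lerXn2r ?nnegrE ?invr_ge0 ?divr_ge0 ?modulus_ge0 ?(ltW r0) //.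
by rewrite ler_pdivrMr // mulrC ler_pdivlMr // mulrC.
Qed.

End Taylor.

(** * Differences of polynomials *)

Section Surjections.

(* The number of surjections from a [k]-set onto a [j]-set, i.e. the [j]-th
   difference of [x ^ k] at [0]. *)
Fixpoint surj j k : nat :=
  if j is j'.+1 then \sum_(i < k) 'C(k, i) * surj j' i else (k == 0)%N.

Lemma surj_small j k : (k < j)%N -> surj j k = 0%N.
Proof.
elim: j k => // j IH k; rewrite ltnS /= => kj.
by apply: big1 => i _; rewrite IH ?muln0 // (leq_trans (ltn_ord i)).
Qed.

Lemma surjnn j : surj j j = j`!.
Proof.
elim: j => // j IH; rewrite [LHS]/= big_ord_recr /= IH big1 ?add0n.
  by rewrite binSn factS.
by move=> i _; rewrite surj_small ?muln0 //= ltn_ord.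
Qed.

Lemma surj_le j k : (surj j k <= j ^ k)%N.
Proof.
elim: j k => [|j IH] k; first by case: k.
rewrite -[X in (X ^ _)%N](addn1 j) addnC expnDn big_ord_recr /=.
apply: leq_trans (leq_addr _ _); apply: leq_sum => i _.
by rewrite exp1n mul1n leq_mul2l IH orbT.
Qed.

(** Raising [k] by one multiplies the binomial by [(q + k + 1) / (k + 1)], which is at most
    [q + 1]. *)
Lemma bin_addl_le q k : ('C(q + k, q) <= q.+1 ^ k)%N.
Proof.
elim: k => [|k IH]; first by rewrite addn0 binn.
rewrite -bin_sub ?leq_addr // addKn -(leq_pmul2l (ltn0Sn k)) -mul_bin_diag.
rewrite addnS /= -[k in 'C(_, k)](addKn q) bin_sub ?leq_addr // expnS mulnA.
by apply: leq_mul IH; nia.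
Qed.

(** Both sides are the multinomial coefficient of [q], [i], [k - i]. *)
Lemma bin_trinomial q k i : (i <= k)%N ->
  ('C(q + k, q + k - i) * 'C(q + k - i, q) = 'C(q + k, q) * 'C(k, i))%N.
Proof.
move=> ik; have e : (q + k - i = q + (k - i))%N by rewrite addnBA.
have ik' : (i <= q + k)%N by exact: leq_trans ik (leq_addl _ _).
have pos : (0 < i`! * (q`! * (k - i)`!))%N by rewrite !muln_gt0 !fact_gt0.
apply/eqP; rewrite -(eqn_pmul2r pos); apply/eqP.
have h1 := bin_fact (leq_subr i (q + k)); rewrite subKn // in h1.
have h2 : ('C(q + k - i, q) * (q`! * (k - i)`!) = (q + k - i)`!)%N.
  by rewrite -[in RHS](bin_fact (m := q)) ?e ?leq_addr // addKn.
have h3 := bin_fact (leq_addr k q); rewrite addKn in h3.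
have h4 := bin_fact ik.
transitivity (q + k)`!.
  by rewrite -h1 -h2; move: 'C(_, _) 'C(_, q) i`! q`! (k - i)`! => a b c d f; ring.
by rewrite -h3 -h4; move: 'C(_, _) 'C(k, i) i`! q`! (k - i)`! => a b c d f; ring.
Qed.

(** Shift equals difference plus identity, read on coefficients. Terms with [p'] outside [[q, p]]
    vanish; in [i = p - p'] the sum is the recursion of [surj] together with its missing term
    [i = p - q]. *)
Lemma surj_convolution j K p q : (q <= p)%N -> (p < K)%N ->
  (\sum_(p' < K) 'C(p, p') * 'C(p', q) * surj j (p - p') =
   'C(p, q) * (surj j.+1 (p - q) + surj j (p - q)))%N.
Proof.
move=> qp; have [k ->] : exists k, p = (q + k)%N by exists (p - q)%N; rewrite subnKC.
move=> pK; rewrite addKn -(big_mkord xpredT (fun p' => 'C(q + k, p') * 'C(p', q) * surj j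
  (q + k - p'))%N).
rewrite (@big_cat_nat _ _ _ (q + k).+1) //= [X in (_ + X)%N]big_nat_cond [X in (_ +
  X)%N]big1 ?addn0; last first.
  by move=> i /andP[/andP[h _] _]; rewrite bin_small.
rewrite (@big_cat_nat _ _ _ q) ?leqW ?leq_addr //= big_nat_cond big1 ?add0n; last first.
  by move=> i /andP[/andP[_ h] _]; rewrite (bin_small h) muln0.
rewrite -[X in \sum_(X <= _ < _) _]add0n -addnS big_addn addnC addnK.
rewrite big_nat_rev /= add0n.
transitivity (\sum_(0 <= i < k.+1) 'C(q + k, q) * ('C(k, i) * surj j i))%N.
  apply: eq_big_nat => i; rewrite ltnS => /= ik.
  have -> : (k.+1 - i.+1 + q = q + k - i)%N by lia.
  have -> : (q + k - (q + k - i) = i)%N by lia.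
  by rewrite bin_trinomial // mulnA.
by rewrite -big_distrr /= big_nat_recr //= binn mul1n big_mkord.
Qed.

End Surjections.

Section PolynomialDifference.
Variables (R : realType) (eta : R[i]).
Local Notation C := R[i].
Implicit Types (P : {poly C}).

Definition poly_difference P := P \Po ('X + eta%:P) - P.

Lemma horner_poly_difference j P z :
  (iter j poly_difference P).[z] = iter j (difference eta) (horner P) z.
Proof.
elim: j z => // j IH z /=.
by rewrite /difference -!IH /poly_difference hornerD hornerN horner_comp !hornerE.
Qed.

Lemma coef_XaddC_exp p q : (('X + eta%:P) ^+ p)`_q = 'C(p, q)%:R * eta ^+ (p - q).
Proof.
elim: p q => [|p IH] [|q].
- by rewrite expr0 coef1 mul1r.
- by rewrite expr0 coef1 bin0n mul0r.
- by rewrite exprS mulrDl coefD coefXM coefCM IH /= !bin0 !mul1r !subn0 exprS add0r.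
rewrite exprS mulrDl coefD coefXM coefCM !IH /= binS subSS natrD mulrDl addrC.
congr (_ + _); have [pq|qp] := leqP p q.
  by rewrite bin_small ?ltnS // !mul0r mulr0.
by rewrite mulrCA -exprS; congr (_ * _ ^+ _); rewrite subnSK.
Qed.

Lemma coef_shift P K q : (size P <= K)%N ->
  (P \Po ('X + eta%:P))`_q = \sum_(p < K) P`_p * ('C(p, q)%:R * eta ^+ (p - q)).
Proof.
move=> PK; rewrite coef_comp_poly.
under eq_bigr do rewrite coef_XaddC_exp.
rewrite (big_ord_widen_cond K xpredT (fun p => P`_p * ('C(p, q)%:R * eta ^+ (p - q)))) //=.
rewrite [RHS](bigID (fun p : 'I_K => p < size P)%N) /= [X in _ = _ + X]big1 ?addr0 //.
by move=> p; rewrite -leqNgt => h; rewrite nth_default // mul0r.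
Qed.

Lemma size_poly_difference P : (size (poly_difference P) <= size P)%N.
Proof.
rewrite (leq_trans (size_polyD _ _)) // size_polyN geq_max leqnn andbT.
have [->|P0] := eqVneq P 0; first by rewrite comp_poly0.
rewrite (leq_trans (size_comp_poly_leq _ _)) // size_XaddC muln1.
by rewrite prednK // lt0n size_poly_eq0.
Qed.

(** Expands the [j]-th difference of each monomial. A common bound [K] lets the induction treat all
    iterates with sums over one range, although their sizes may drop. *)
Lemma coef_poly_difference j P K q : (size P <= K)%N ->
  (iter j poly_difference P)`_q =
  \sum_(p < K) P`_p * (('C(p, q) * surj j (p - q))%N%:R * eta ^+ (p - q)).
Proof.
move=> PK; elim: j q => [|j IH] q /=.
  have [qK|Kq] := ltnP q K.
    rewrite (bigD1 (Ordinal qK)) //= binn subnn mul1n mulr1 big1 ?addr0 ?mulr1 //.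
    move=> p pq; have {}pq : (p != q :> nat) by rewrite -val_eqE in pq.
    have [pq'|qp|e] := ltngtP p q; last by rewrite e eqxx in pq.
      by rewrite bin_small // mul0n mul0r mulr0.
    by rewrite subn_eq0 leqNgt qp muln0 mul0r mulr0.
  rewrite nth_default ?(leq_trans PK) // big1 // => p _.
  by rewrite bin_small ?mul0n ?mul0r ?mulr0 // (leq_trans (ltn_ord p)).
set Q := iter j _ P in IH *.
have QK : (size Q <= K)%N.
  apply: leq_trans PK; rewrite /Q; elim: (j) => //= m; apply: leq_trans.
  exact: size_poly_difference.
rewrite coefB (coef_shift _ QK) IH.
under [X in X - _]eq_bigr => p' _.
  rewrite IH mulr_suml; under eq_bigr do rewrite -mulrA.
  over.
rewrite exchange_big /= -sumrB; apply: eq_bigr => p _.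
rewrite -mulr_sumr -mulrBr; congr (_ * _).
have [pq|qp] := ltnP p q.
  rewrite bin_small // !mul0n !mul0r subr0 big1 // => p' _.
  have [pp'|p'p] := ltnP p p'; first by rewrite bin_small // mul0n !mul0r.
  by rewrite ['C(p', q)]bin_small ?(leq_ltn_trans p'p) // mul0r mulr0.
transitivity (\sum_(p' < K) ('C(p, p') * 'C(p', q) * surj j (p - p'))%N%:R * eta ^+ (p - q)
    - ('C(p, q) * surj j (p - q))%N%:R * eta ^+ (p - q)).
  congr (_ - _); apply: eq_bigr => p' _.
  have [pp'|p'p] := ltnP p p'; first by rewrite bin_small // !mul0n !mul0r.
  have [p'q|qp'] := ltnP p' q.
    by rewrite ['C(p', q)]bin_small // muln0 !mul0n !mul0r mulr0.
  have -> : (p - q = (p - p') + (p' - q))%N by lia.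
  by rewrite exprD !natrM; ring.
rewrite -mulr_suml -mulrBl -natr_sum surj_convolution ?ltn_ord //.
by rewrite mulnDr natrD addrK.
Qed.

Lemma geometric_tail (x : R) m K : 0 <= x -> x <= 2^-1 ->
  \sum_(p < K | (m <= p)%N) x ^+ (p - m) <= 2.
Proof.
move=> x0 x2.
have geo n : \sum_(i < n) x ^+ i <= 2.
  have h := subrX1 x n; have xn : 0 <= x ^+ n by rewrite exprn_ge0.
  have s0 : 0 <= \sum_(i < n) x ^+ i by rewrite sumr_ge0 // => i _; rewrite exprn_ge0.
  by move: (\sum_(i < n) x ^+ i) (x ^+ n) h xn s0 => s y; nra.
have [Km|mK] := leqP K m.
  rewrite big1 // => p mp; have := ltn_ord p; lia.
rewrite -(big_mkord (fun p => m <= p)%N (fun p => x ^+ (p - m))).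
rewrite (@big_cat_nat _ _ _ m) ?(ltnW mK) //= big_nat_cond big1 ?add0r; last first.
  by move=> i /andP[/andP[_ h]]; rewrite leqNgt h.
rewrite -{1}[m]add0n big_addn.
have -> : \sum_(0 <= i < K - m | (m <= i + m)%N) x ^+ (i + m - m) = \sum_(i < K - m) x ^+ i.
  by rewrite big_mkord; apply: eq_big => i; rewrite ?leq_addl // addnK.
exact: geo.
Qed.

(** The term [p = q + j] is the leading one, since [surj j (p - q)] vanishes below it. For
    [p = q + k] the bounds [surj_le] and [bin_addl_le] give at most [mu * x ^ k / r ^ q], a
    geometric series starting at [k = j + 1]. *)
Lemma poly_difference_estimate (P : {poly C}) j n q (r mu x : R) :
  (j <= n)%N -> 0 < r -> (forall p, modulus P`_p * r ^+ p <= mu) ->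
  x = q.+1%:R * (n%:R * modulus eta) / r -> x <= 2^-1 ->
  modulus ((iter j poly_difference P)`_q - P`_(q + j) * (((q + j) ^_ j)%:R * eta ^+ j))
    <= 2 * mu * x ^+ j.+1 / r ^+ q.
Proof.
move=> jn r0 Pmu xE x2.
have mu0 : 0 <= mu by rewrite (le_trans _ (Pmu 0%N)) // mulr_ge0 ?modulus_ge0 ?exprn_ge0
  // ltW.
have x0 : 0 <= x by rewrite xE !mulr_ge0 ?modulus_ge0 ?invr_ge0 // ltW.
pose K := maxn (size P) (q + j).+1.
have qjK : (q + j < K)%N by rewrite leq_maxr.
rewrite (coef_poly_difference j q (leq_maxl (size P) (q + j).+1)) -/K.
rewrite (bigD1 (Ordinal qjK)) //= [(q + j - q)%N]addKn surjnn.
have -> : ('C(q + j, q) * j`! = (q + j) ^_ j)%N.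
  by rewrite -bin_ffact -bin_sub ?leq_addr // addKn.
rewrite addrAC subrr add0r; apply: le_trans (modulus_sum _ _ _) _.
apply: (@le_trans _ _ (\sum_(p < K | (q + j.+1 <= p)%N) mu * x ^+ j.+1 / r ^+ q * x ^+ (p
  - (q + j.+1)))); last first.
  rewrite -mulr_sumr.
  have -> : 2 * mu * x ^+ j.+1 / r ^+ q = mu * x ^+ j.+1 / r ^+ q * 2 by ring.
  rewrite ler_wpM2l //.
    by rewrite !mulr_ge0 ?invr_ge0 ?exprn_ge0 // ltW.
  exact: geometric_tail.
rewrite [leRHS]big_mkcond [leLHS]big_mkcond /=; apply: ler_sum => p _.
have [qp|pq] := leqP (q + j.+1) p; last first.
  case: eqP => //= pqj; have [h|h] := ltnP p q.
    by rewrite bin_small // mul0n mul0r mulr0 modulus0.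
  have : (p != q + j :> nat)%N by apply/eqP => e; apply: pqj; apply: val_inj.
  by move=> e; rewrite surj_small ?muln0 ?mul0r ?mulr0 ?modulus0 //; lia.
have -> : p != Ordinal qjK.
  by apply/eqP => e; move: qp; rewrite e /= addnS ltnn.
rewrite !modulusM modulusX modulus_nat natrM /=.
have [k pE] : exists k, (p = q + k :> nat)%N by exists (p - q)%N; lia.
have kj : (j.+1 <= k)%N by lia.
have -> : mu * x ^+ j.+1 / r ^+ q * x ^+ (p - (q + j.+1)) = mu / r ^+ p * (q.+1%:R ^+ k *
  (n%:R ^+ k * modulus eta ^+ k)).
  have -> : (p - (q + j.+1) = k - j.+1)%N by lia.
  transitivity (mu / r ^+ q * x ^+ k).
    by rewrite -[in RHS](subnK kj) exprD; ring.
  by rewrite xE pE exprD expr_div_n !exprMn; field; rewrite !expf_neq0 ?gt_eqF.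
rewrite pE addKn; apply: ler_pM; rewrite ?mulr_ge0 ?modulus_ge0 ?exprn_ge0 ?modulus_ge0 //.
  by rewrite ler_pdivlMr ?exprn_gt0.
rewrite -mulrA; apply: ler_pM; rewrite ?mulr_ge0 ?modulus_ge0 ?exprn_ge0 ?modulus_ge0 //.
  by rewrite -natrX ler_nat bin_addl_le.
rewrite ler_wpM2r ?exprn_ge0 ?modulus_ge0 // -natrX ler_nat.
by rewrite (leq_trans (surj_le _ _)) // leq_exp2r ?(leq_trans _ kj).
Qed.

(** A Cauchy estimate by iterated quotients on the unit circle; the loss [2 ^ m] is harmless for a
    fixed index [m]. *)
Lemma poly_coef_bound (P : {poly C}) (S : R) m :
  (forall z, modulus z = 1 -> modulus P.[z] <= S) -> modulus P`_m <= 2 ^+ m * S.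
Proof.
have h0 (p : {poly C}) (T : R) :
    (forall z, modulus z = 1 -> modulus p.[z] <= T) -> modulus p`_0 <= T.
  move=> pT; rewrite -horner_coef0; apply: (entire_mean (@entire_horner _ p) ltr01) => z.
  by rewrite subr0; exact: pT.
elim: m P S => [|m IH] P S PS; first by rewrite expr0 mul1r h0.
pose Q : {poly C} := \poly_(i < (size P).-1) P`_i.+1.
have PQ : P = (P`_0)%:P + 'X * Q.
  apply/polyP => -[|i]; rewrite coefD coefC coefXM /= ?addr0 // add0r coef_poly.
  by case: ltnP => // h; rewrite nth_default // (leq_trans (leqSpred _)) ?ltnS.
have -> : P`_m.+1 = Q`_m by rewrite PQ coefD coefC coefXM /= add0r.
rewrite exprSr -mulrA; apply: IH => z z1.
have -> : modulus Q.[z] = modulus (P.[z] - P`_0).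
  by rewrite {1}PQ !hornerE addrAC subrr add0r modulusM z1 mul1r.
by rewrite (le_trans (modulusB _ _)) // mulr2n mulrDl mul1r lerD ?h0 ?PS.
Qed.

End PolynomialDifference.

(** * Central index and growth *)

Section CentralIndex.
Variable R : realType.
Local Notation C := R[i].
Implicit Types (f g : C -> C).

Lemma difference_bound (eta : C) g j (rho d : R) :
  (forall w, modulus w <= rho + j%:R * modulus eta -> modulus (g w) <= d) ->
  forall z, modulus z <= rho -> modulus (iter j (difference eta) g z) <= 2 ^+ j * d.
Proof.
elim: j rho => [|j IH] rho gd z zr.
  by rewrite mul1r gd // mul0r addr0.
rewrite /= /difference exprS -mulrA mulr2n mulrDl mul1r.
apply: le_trans (modulusB _ _) _; apply: lerD.
  apply: (IH (rho + modulus eta)).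
    move=> w; have -> : rho + modulus eta + j%:R * modulus eta =
      rho + j.+1%:R * modulus eta by rewrite -natr1; ring.
    exact: gd.
  by rewrite (le_trans (modulusD _ _)) // lerD2r.
apply: (IH rho) => // w wr; apply: gd; apply: le_trans wr _.
by rewrite lerD2l ler_wpM2r ?modulus_ge0 // ler_nat.
Qed.

Lemma differenceB (eta : C) f g j z :
  iter j (difference eta) (fun w => f w - g w) z =
  iter j (difference eta) f z - iter j (difference eta) g z.
Proof.
elim: j z => // j IH z /=.
by rewrite /difference !IH; ring.
Qed.

Lemma ffact_le_exp k j : (k ^_ j <= k ^ j)%N.
Proof.
elim: j k => // j IH k; rewrite ffactnS expnS leq_mul2l; apply/orP; right.
by rewrite (leq_trans (IH _)) //; case: j {IH} => // j; rewrite leq_exp2r // leq_pred.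
Qed.

Lemma exp_le_ffact k j n : (j <= n)%N -> (2 * n <= k)%N -> (k ^ j <= 2 ^ j * k ^_ j)%N.
Proof.
move=> jn nk; elim: j jn => // j IH jn.
rewrite ffactnSr !expnS mulnC -[leqRHS]mulnA [leqRHS]mulnCA.
have -> : (2 ^ j * (2 * (k ^_ j * (k - j))) = (2 ^ j * k ^_ j) * (2 * (k - j)))%N by ring.
by rewrite leq_mul ?IH ?(ltnW jn) //; lia.
Qed.

Variables (eta : C) (n : nat) (a : 'I_n.+1 -> {poly C}).
Hypothesis eta_neq0 : eta != 0.

Let deg j := (size (a j)).-1.
Definition central (c : nat -> C) (r : R) N :=
  forall p, modulus (c p) * r ^+ p <= modulus (c N) * r ^+ N.
Definition weight (r : R) (N : nat) (j : 'I_n.+1) := (N%:R / r) ^+ j * r ^+ (size (a j)).-1.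

(** The equation on polynomials; [f] enters through its Taylor truncations. *)
Definition operator (P : {poly C}) :=
  \sum_(j < n.+1) a j * iter j (poly_difference eta) P.

Lemma coef_operator P m : (forall j, size (a j) <= m.+1)%N ->
  (operator P)`_m = \sum_(j < n.+1) \sum_(l < size (a j))
    (a j)`_l * (iter j (poly_difference eta) P)`_(m - l).
Proof.
move=> am; rewrite /operator coef_sum; apply: eq_bigr => j _.
rewrite coefM [RHS](big_ord_widen_cond m.+1 xpredT
  (fun l => (a j)`_l * (iter j (poly_difference eta) P)`_(m - l))) //=.
rewrite [LHS](bigID (fun l : 'I_m.+1 => l < size (a j))%N) /= [X in _ + X]big1 ?addr0 //.
by move=> l; rewrite -leqNgt => h; rewrite nth_default // mul0r.
Qed.

(** One [y] serves all [j] and [q] in play, with [2 * N] in place of [q + 1]. The factor [n.+1] is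
    at least 1 even if [n = 0], as the bound on the leading term requires. *)
Lemma difference_coef_bound (P : {poly C}) j (N q : nat) (r mu : R) :
  let y := 2 * N%:R * (n.+1%:R * modulus eta) / r in
  (j <= n)%N -> 0 < r -> (forall p, modulus P`_p * r ^+ p <= mu) ->
  (q + n.+1 <= 2 * N)%N -> y <= 2^-1 ->
  modulus ((iter j (poly_difference eta) P)`_q -
      P`_(q + j) * (((q + j) ^_ j)%:R * eta ^+ j)) <= 2 * mu * y ^+ j.+1 / r ^+ q /\
  modulus ((iter j (poly_difference eta) P)`_q) <= 2 * mu * y ^+ j / r ^+ q.
Proof.
move=> y jn r0 Pmu qN y2.
have mu0 : 0 <= mu by rewrite (le_trans _ (Pmu 0%N)) // mulr_ge0 ?modulus_ge0 ?exprn_ge0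
  // ltW.
have e0 := modulus_ge0 eta.
have rq : 0 < r ^+ q by rewrite exprn_gt0.
pose x := q.+1%:R * (n.+1%:R * modulus eta) / r.
have x0 : 0 <= x by rewrite /x !mulr_ge0 ?invr_ge0 // ltW.
have xy : x <= y.
  rewrite /x /y ler_wpM2r ?invr_ge0 ?(ltW r0) // ler_wpM2r ?mulr_ge0 //.
  by rewrite -natrM ler_nat; lia.
have y0 : 0 <= y by exact: le_trans xy.
have est := poly_difference_estimate (leqW jn) r0 Pmu (erefl x) (le_trans xy y2).
have est1 : modulus ((iter j (poly_difference eta) P)`_q -
    P`_(q + j) * (((q + j) ^_ j)%:R * eta ^+ j)) <= 2 * mu * y ^+ j.+1 / r ^+ q.
  apply: le_trans est _; rewrite ler_wpM2r ?invr_ge0 ?(ltW rq) //.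
  by rewrite ler_wpM2l ?mulr_ge0 // lerXn2r ?nnegrE.
split=> //.
have main : modulus (P`_(q + j) * (((q + j) ^_ j)%:R * eta ^+ j)) <= mu * y ^+ j / r ^+ q.
  rewrite !modulusM modulusX modulus_nat.
  apply: (@le_trans _ _ (mu / r ^+ (q + j) * ((2 * N%:R) ^+ j * (n.+1%:R * modulus eta)
    ^+ j))).
    apply: ler_pM; rewrite ?modulus_ge0 ?mulr_ge0 ?exprn_ge0 //.
      by rewrite ler_pdivlMr ?exprn_gt0.
    apply: ler_pM; rewrite ?exprn_ge0 //; last first.
      by rewrite lerXn2r ?nnegrE ?mulr_ge0 // ler_peMl // ler1n.
    rewrite -natrM -natrX ler_nat (leq_trans (ffact_le_exp _ _)) //.
    have qj : (q + j <= 2 * N)%N by apply: leq_trans qN; rewrite leq_add2l leqW.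
    by case: (j) qj => // j' qj; rewrite leq_exp2r.
  rewrite -exprMn /y expr_div_n exprD le_eqVlt; apply/orP; left; apply/eqP.
  by field; rewrite !expf_neq0 ?gt_eqF.
rewrite -[X in modulus X](subrK (P`_(q + j) * (((q + j) ^_ j)%:R * eta ^+ j))).
apply: le_trans (modulusD _ _) _; apply: le_trans (lerD est1 main) _.
have -> : 2 * mu * y ^+ j.+1 / r ^+ q + mu * y ^+ j / r ^+ q =
    (mu * y ^+ j / r ^+ q) * (2 * y + 1) by rewrite exprS; ring.
have -> : 2 * mu * y ^+ j / r ^+ q = (mu * y ^+ j / r ^+ q) * 2 by ring.
rewrite ler_wpM2l ?mulr_ge0 ?exprn_ge0 ?invr_ge0 ?(ltW rq) //; lra.
Qed.

(* In the coefficient of index [N - j0 + deg (a j0)] of the equation, the leading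
   term of [a j0] contributes [c N] times a factor of order [weight r N j0]; since
   [N] is central, [c N] controls all the other coefficients of the series. *)
Lemma no_dominant_weight (c : nat -> C) (j0 : 'I_n.+1) : a j0 != 0 ->
  (forall m (e : R), 0 < e -> exists K0, forall K, (K0 <= K)%N ->
     modulus (operator (\poly_(i < K) c i))`_m <= e) ->
  exists kappa : R, 0 < kappa /\ exists N0, forall (r : R) N,
    kappa^-1 <= r -> (N0 <= N)%N -> N%:R <= kappa * r ->
    central c r N -> c N != 0 ->
    exists j : 'I_n.+1, [/\ a j != 0, j != j0 & kappa * weight r N j0 < weight r N j].
Proof.
move=> a0 Tc.
pose B : R := n.+1%:R * modulus eta.
(* Absorbs the constant of [y ^ j] for all [j <= n.+1] at once. *)
pose G : R := (1 + 2 * B) ^+ n.+1.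
pose L : R := \sum_(j < n.+1) \sum_(l < size (a j)) modulus (a j)`_l.
pose S : R := \sum_(j < n.+1) \sum_(l < size (a j)) 1.
(* The divisor 2 pays for replacing the falling factorial by [N ^ j0]. *)
pose lam : R := modulus (lead_coef (a j0)) * (modulus eta / 2) ^+ j0.
pose D : R := 2 * L * G * S.
have B0 : 0 < B by rewrite mulr_gt0 ?modulus_gt0.
have G1 : 1 <= G by rewrite exprn_ege1 // lerDl mulr_ge0 // ltW.
have L0 : 0 <= L by rewrite !sumr_ge0 // => j _; rewrite sumr_ge0 // => l _; exact:
  modulus_ge0.
have S0 : 0 <= S by rewrite !sumr_ge0 // => j _; rewrite sumr_ge0.
have lam0 : 0 < lam.
  by rewrite mulr_gt0 ?exprn_gt0 ?divr_gt0 ?modulus_gt0 // lead_coef_eq0.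
have D0 : 0 <= D by rewrite !mulr_ge0 // (le_trans ler01).
have aL j l : (l < size (a j))%N -> modulus (a j)`_l <= L.
  move=> la; rewrite /L (bigD1 j) //= (bigD1 (Ordinal la)) //= -addrA lerDl.
  rewrite addr_ge0 // !sumr_ge0 // => i _; rewrite ?sumr_ge0 ?modulus_ge0 // => l' _.
  exact: modulus_ge0.
(* The second bound gives [y <= 1/2]; the third keeps the total error within a quarter of the main
   term. *)
pose kappa : R := Num.min 1 (Num.min (4 * B)^-1 (lam / (4 * (D + 1)))).
have D1 : 0 < D + 1 by rewrite ltr_wpDl.
have k0 : 0 < kappa by rewrite !lt_min ltr01 /= invr_gt0 mulr_gt0 //= divr_gt0 // mulr_gt0.
have k1 : kappa <= 1 by rewrite ge_min lexx.
have kB : kappa * (4 * B) <= 1.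
  have B4 : 0 < 4 * B by rewrite mulr_gt0.
  have h : kappa <= 1 / (4 * B) by rewrite div1r !ge_min lexx orbT.
  by rewrite ler_pdivlMr in h.
have kD : D * kappa <= lam / 4.
  have : kappa <= lam / (4 * (D + 1)) by rewrite !ge_min lexx !orbT.
  rewrite ler_pdivlMr ?mulr_gt0 // => h.
  by rewrite ler_pdivlMr //; apply: le_trans h; nra.
exists kappa; split=> //.
have [A sA] : exists A, forall j, (size (a j) <= A)%N.
  by exists (\sum_(j < n.+1) size (a j))%N => j; rewrite (bigD1 j) //= leq_addr.
(* Large enough for all coefficient indices in play to stay below [2 * N], and for [2 * n <= N] as
   [exp_le_ffact] demands. *)
exists (2 * n + 2 * A + 2)%N => r N rk N0 Nr cen cN.
apply: contrapT => nex.
have Vle (j : 'I_n.+1) : a j != 0 -> j != j0 -> weight r N j <= kappa * weight r N j0.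
  by move=> aj jj; rewrite leNgt; apply/negP => h; apply: nex; exists j.
have r1 : 1 <= r by apply: le_trans rk; rewrite invf_ge1.
have r0 : 0 < r by apply: lt_le_trans r1.
have N1 : 0 < N%:R :> R by rewrite ltr0n (leq_trans _ N0) // addn2.
pose X : R := N%:R / r.
have X0 : 0 < X by rewrite divr_gt0.
have Xk : X <= kappa by rewrite ler_pdivrMr.
pose y : R := 2 * N%:R * (n.+1%:R * modulus eta) / r.
have yX : y = 2 * B * X by rewrite /y /B /X; ring.
have y2 : y <= 2^-1.
  rewrite yX; apply: le_trans (ler_wpM2l (mulr_ge0 (ler0n R 2) (ltW B0)) Xk) _.
  by move: kB; set b := B; set k := kappa; lra.
have yG j : (j <= n.+1)%N -> y ^+ j <= G * X ^+ j.
  move=> jn; rewrite yX exprMn ler_wpM2r ?exprn_ge0 ?(ltW X0) //.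
  apply: (@le_trans _ _ ((1 + 2 * B) ^+ j)).
    have B2 : 0 <= 2 * B by rewrite mulr_ge0 // ltW.
    by rewrite lerXn2r ?nnegrE ?lerDr // addr_ge0.
  by rewrite ler_weXn2l // lerDl mulr_ge0 // ltW.
pose m := (N - j0 + deg j0)%N.
have j0n := ltn_ord j0.
have sj0 := sA j0.
have j0N : (j0 <= N)%N by clear -N0 j0n; lia.
have dj0 : ((deg j0).+1 = size (a j0))%N by rewrite prednK // lt0n size_poly_eq0.
have am j : (size (a j) <= m.+1)%N by have := sA j; rewrite /m; clear -N0 sj0 dj0 j0n; lia.
pose mu := modulus (c N) * r ^+ N.
have mu0 : 0 < mu by rewrite mulr_gt0 ?exprn_gt0 ?modulus_gt0.
have c0 : 0 <= 2 * L * mu / r ^+ m.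
  by rewrite divr_ge0 ?exprn_ge0 ?(ltW r0) // mulr_ge0 ?(ltW mu0) // mulr_ge0.
have c1 : 0 <= 2 * L * mu * r ^+ deg j0 / r ^+ m.
  by rewrite mulrAC mulr_ge0 // exprn_ge0 // ltW.
pose V := weight r N j0.
have V0 : 0 < V by rewrite mulr_gt0 ?exprn_gt0.
have e0 : 0 < lam / 4 * V * mu / r ^+ m by rewrite divr_gt0 ?exprn_gt0 // mulr_gt0 //
  mulr_gt0 // divr_gt0.
have [K0 /(_ (maxn K0 N.+1) (leq_maxl _ _))] := Tc m _ e0.
set K := maxn _ _; have NK : (N < K)%N by rewrite leq_maxr.
set P := \poly_(i < K) c i.
have Pmu p : modulus P`_p * r ^+ p <= mu.
  rewrite coef_poly; case: ifP => _; first exact: cen.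
  by rewrite modulus0 mul0r ltW.
pose main := lead_coef (a j0) * (c N * ((N ^_ j0)%:R * eta ^+ j0)).
rewrite coef_operator //.
pose t (j : 'I_n.+1) l := (a j)`_l * (iter j (poly_difference eta) P)`_(m - l).
pose d (j : 'I_n.+1) l := if (j == j0) && (l == deg j0) then main else 0.
(* Three sources of the factor [kappa]: for [j != j0] the assumption [Vle]; for a lower coefficient
   of [a j0] the lost power of [r], as [r >= kappa^-1]; for the leading one the extra factor
   [X <= kappa] of the remainder. *)
have tb j l : (l < size (a j))%N -> modulus (t j l - d j l) <= 2 * L * G * kappa * V * mu
  / r ^+ m.
  move=> la; have lA := leq_trans la (sA j).
  have lm : (l <= m)%N by rewrite -ltnS (leq_trans la).
  have jn : (j <= n)%N by rewrite -ltnS.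
  have qN : (m - l + n.+1 <= 2 * N)%N by rewrite /m; clear -N0 sj0 dj0 j0n; lia.
  have [est1 est2] := difference_coef_bound jn r0 Pmu qN y2.
  have rml : (r ^+ (m - l))^-1 = r ^+ l / r ^+ m.
    by rewrite -{2}(subnK lm) exprD; field; rewrite !expf_neq0 ?gt_eqF.
  rewrite rml in est1 est2.
  have gen : X ^+ j * r ^+ l <= kappa * V ->
      modulus (t j l) <= 2 * L * G * kappa * V * mu / r ^+ m.
    move=> h; rewrite /t modulusM.
    apply: le_trans (ler_pM (modulus_ge0 _) (modulus_ge0 _) (aL j l la) est2) _.
    have -> : L * (2 * mu * y ^+ j * (r ^+ l / r ^+ m)) = (2 * L * mu / r ^+ m) * (y ^+ j
      * r ^+ l).
      by ring.
    have -> : 2 * L * G * kappa * V * mu / r ^+ m = (2 * L * mu / r ^+ m) * (G * (kappa *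
      V)).
      by ring.
    rewrite (ler_wpM2l c0) //.
    apply: (@le_trans _ _ (G * (X ^+ j * r ^+ l))).
      by rewrite [leRHS]mulrA ler_wpM2r ?exprn_ge0 ?(ltW r0) // yG // leqW.
    by rewrite ler_wpM2l // (le_trans ler01).
  have [jj|jj] := eqVneq j j0; last first.
    rewrite /d (negPf jj) /= subr0; apply: gen.
    have aj : a j != 0 by rewrite -size_poly_gt0 (leq_ltn_trans _ la).
    apply: le_trans (Vle j aj jj); rewrite ler_wpM2l ?exprn_ge0 ?(ltW X0) //.
    by rewrite ler_weXn2l // -ltnS prednK // (leq_ltn_trans _ la).
  have [ll|ll] := eqVneq l (deg j0); last first.
    rewrite /d (negPf ll) andbF subr0; apply: gen; rewrite jj /V /weight.
    rewrite mulrCA ler_wpM2l ?exprn_ge0 ?(ltW X0) //.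
    have ld : (l.+1 <= deg j0)%N by move: la ll; rewrite jj -dj0; clear; lia.
    rewrite mulrC -ler_pdivrMr // .
    apply: (@le_trans _ _ (r ^+ l * r)).
      rewrite ler_wpM2l ?exprn_ge0 ?(ltW r0) //.
    by rewrite -exprSr ler_weXn2l.
  rewrite /d jj ll !eqxx /= /t /main -/(lead_coef _) -mulrBr modulusM.
  rewrite jj ll in est1.
  have qE : (m - deg j0 + j0 = N)%N by rewrite /m; clear -N0 j0n; lia.
  rewrite qE coef_poly NK in est1.
  apply: le_trans (ler_pM (modulus_ge0 _) (modulus_ge0 _) (aL j0 (deg j0) _) est1) _.
    by rewrite dj0.
  have -> : L * (2 * mu * y ^+ j0.+1 * (r ^+ deg j0 / r ^+ m)) =
      (2 * L * mu * r ^+ deg j0 / r ^+ m) * y ^+ j0.+1 by ring.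
  have -> : 2 * L * G * kappa * V * mu / r ^+ m = 
      (2 * L * mu * r ^+ deg j0 / r ^+ m) * (G * kappa * X ^+ j0).
    by rewrite /V /weight -/X -/(deg j0); ring.
  rewrite (ler_wpM2l c1) //.
  apply: le_trans (yG _ j0n) _; rewrite exprS -mulrA ler_wpM2l ?(le_trans ler01) //.
  by rewrite ler_wpM2r ?exprn_ge0 // ltW.
have sumd : \sum_(j < n.+1) \sum_(l < size (a j)) d j l = main.
  have ld : (deg j0 < size (a j0))%N by rewrite dj0.
  rewrite (bigD1 j0) //= (bigD1 (Ordinal ld)) //= /d !eqxx /= !big1 ?addr0 //.
    by move=> j jj; rewrite big1 // => l _; rewrite (negPf jj).
  by move=> l ll; rewrite ifF //; apply: contra_neqF ll => /eqP ll; apply: val_inj.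
have diff : modulus (\sum_(j < n.+1) \sum_(l < size (a j)) t j l - main) <= D * kappa * V
  * mu / r ^+ m.
  rewrite -sumd -sumrB; under eq_bigr do rewrite -sumrB.
  apply: le_trans (modulus_sum _ _ _) _.
  apply: (@le_trans _ _ (\sum_(j < n.+1) \sum_(l < size (a j)) (2 * L * G * kappa * V *
    mu / r ^+ m) * 1)).
    apply: ler_sum => j _; apply: le_trans (modulus_sum _ _ _) _.
    by apply: ler_sum => l _; rewrite mulr1 tb.
  under eq_bigr do rewrite -mulr_sumr.
  rewrite -mulr_sumr -/S /D le_eqVlt; apply/orP; left; apply/eqP; ring.
have mainb : lam * V * mu / r ^+ m <= modulus main.
  rewrite /main !modulusM modulusX modulus_nat.
  have -> : lam * V * mu / r ^+ m = modulus (lead_coef (a j0)) *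
     (modulus (c N) * ((N ^ j0)%:R / 2 ^+ j0 * modulus eta ^+ j0)).
    rewrite /lam /V /weight /mu -/(deg j0) natrX !expr_div_n.
    have -> : r ^+ m = r ^+ deg j0 * r ^+ N / r ^+ j0.
      rewrite /m -{2}(subnK j0N).
      by rewrite !exprD; field; rewrite !expf_neq0 ?gt_eqF.
    by field; rewrite !expf_neq0 ?gt_eqF.
  rewrite !ler_wpM2l ?modulus_ge0 // ler_wpM2r ?exprn_ge0 ?modulus_ge0 //.
  rewrite ler_pdivrMr ?exp2_gt0 // -natrX -natrM ler_nat mulnC.
  by apply: (@exp_le_ffact _ _ n); clear -N0 j0n; lia.
move=> small.
have tri : modulus main <= modulus (\sum_(j < n.+1) \sum_(l < size (a j)) t j l)
    + modulus (\sum_(j < n.+1) \sum_(l < size (a j)) t j l - main).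
  by rewrite -{1}(subKr (\sum_(j < n.+1) \sum_(l < size (a j)) t j l) main) modulusB.
pose u := V * mu / r ^+ m.
have u0 : 0 < u by rewrite divr_gt0 ?exprn_gt0 // mulr_gt0.
(* The main term is at least [lam * u], but the smallness of the coefficient and the error account
   for at most [lam / 4 * u] each. *)
have := le_trans mainb (le_trans tri (lerD small diff)).
have -> : lam * V * mu / r ^+ m = lam * u by rewrite /u; ring.
have -> : lam / 4 * V * mu / r ^+ m + D * kappa * V * mu / r ^+ m = (lam / 4 + D * kappa)
  * u.
  by rewrite /u; ring.
rewrite ler_pM2r // leNgt => /negP; apply.
apply: le_lt_trans (lerD (lexx _) kD) _; lra.
Qed.

End CentralIndex.

(** * Central index and maximum modulus *)

Section EntireGrowth.
Variable R : realType.
Local Notation C := R[i].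
Variables (f : C -> C) (c : nat -> C).
Hypothesis f_entire : entire f.
Hypothesis c_bound : forall (r M : R) m, 0 < r ->
  (forall z, modulus z = r -> modulus (f z) <= M) -> modulus (c m) <= M * (2 / r) ^+ m.
Hypothesis c_approx : forall (r M : R) k w, 0 < r ->
  (forall z, modulus z <= 4 * r -> modulus (f z) <= M) -> modulus w <= r ->
  modulus (f w - \sum_(m < k) c m * w ^+ m) <= M * (modulus w / r) ^+ k.

Lemma geometric_small (M e : R) : 0 < e ->
  exists K0, forall K, (K0 <= K)%N -> M * 2^-1 ^+ K <= e.
Proof.
move=> e0; have q : 0 < e / (`|M| + 1) by rewrite divr_gt0 // ltr_wpDl.
have [K0 K0P] := inv_exp2_small q; exists K0 => K /K0P.
rewrite exprVn ltr_pdivlMr ?ltr_wpDl // => h; apply: le_trans (ltW h).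
by rewrite mulrC ler_wpM2l ?invr_ge0 ?exprn_ge0 // (le_trans (ler_norm _)) // lerDl.
Qed.

Lemma taylor_uniform (rho e : R) : 0 < e -> exists K0, forall K, (K0 <= K)%N ->
  forall w, modulus w <= rho -> modulus (f w - \sum_(m < K) c m * w ^+ m) <= e.
Proof.
move=> e0; pose r := 2 * (`|rho| + 1).
have r0 : 0 < r by rewrite mulr_gt0 // ltr_wpDl.
have [M MP] := entire_bounded (4 * r) f_entire.
have M0 : 0 <= M.
  by apply: le_trans (modulus_ge0 (f 0)) (MP _ _); rewrite modulus0 mulr_ge0 // ltW.
have [K0 K0P] := geometric_small M e0; exists K0 => K /K0P KK w wr.
have wr' : modulus w / r <= 2^-1.
  by rewrite ler_pdivrMr // /r mulKf // (le_trans wr) // (le_trans (ler_norm _)) // lerDl.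
apply: le_trans (c_approx K r0 MP _) _.
  by have := ler_norm rho; have := normr_ge0 rho; rewrite /r; lra.
apply: le_trans KK; rewrite ler_wpM2l // lerXn2r ?nnegrE ?invr_ge0 //.
by rewrite divr_ge0 ?modulus_ge0 // ltW.
Qed.

(** Since the equation annihilates [f], applying it to a truncation equals, up to sign, applying it
    to the Taylor remainder, which is uniformly small on discs; [poly_coef_bound] passes to
    coefficients. *)
Lemma operator_truncation (eta : C) n (a : 'I_n.+1 -> {poly C}) :
  (forall z, \sum_(j < n.+1) (a j).[z] * iter j (difference eta) f z = 0) ->
  forall m (e : R), 0 < e -> exists K0, forall K, (K0 <= K)%N ->
    modulus (operator eta a (\poly_(i < K) c i))`_m <= e.
Proof.
move=> fsol m e e0.
have /choice[A AP] : forall j, exists M, forall z, modulus z <= 1 -> modulus (a j).[z] <= M.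
  by move=> j; exact: entire_bounded 1 (@entire_horner R (a j)).
pose S := \sum_(j < n.+1) `|A j| * 2 ^+ j.
have S0 : 0 <= S by rewrite sumr_ge0 // => j _; rewrite mulr_ge0 ?exprn_ge0.
pose d := e / (2 ^+ m * (S + 1)).
have d0 : 0 < d by rewrite divr_gt0 // mulr_gt0 ?exprn_gt0 // ltr_wpDl.
(* On the unit circle, differences up to order [n] read values up to [n] steps [eta] away. *)
have [K0 K0P] := taylor_uniform (1 + n%:R * modulus eta) d0.
exists K0 => K /K0P {}K0P.
set P := \poly_(i < K) c i.
apply: le_trans (_ : 2 ^+ m * (S * d) <= _); last first.
  have S1 : 0 < S + 1 by rewrite ltr_wpDl.
  have -> : 2 ^+ m * (S * d) = e * (S / (S + 1)).
    by rewrite /d; field; rewrite (gt_eqF S1) gt_eqF ?exprn_gt0.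
  by rewrite ler_piMr ?(ltW e0) // ler_pdivrMr // mul1r lerDl.
apply: poly_coef_bound => z z1.
have -> : (operator eta a P).[z] =
    - \sum_(j < n.+1) (a j).[z] * iter j (difference eta) (fun w => f w - P.[w]) z.
  transitivity ((operator eta a P).[z] -
      \sum_(j < n.+1) (a j).[z] * iter j (difference eta) f z).
    by rewrite fsol subr0.
  rewrite /operator horner_sum -opprB -sumrB; congr (- _).
  by apply: eq_bigr => j _; rewrite hornerM horner_poly_difference differenceB mulrBr.
rewrite modulusN; apply: le_trans (modulus_sum _ _ _) _.
rewrite /S mulr_suml; apply: ler_sum => j _; rewrite modulusM -mulrA.
apply: ler_pM; rewrite ?modulus_ge0 //.
  by rewrite (le_trans (AP _ _ _)) ?z1 // ler_norm.
apply: (@difference_bound _ _ _ _ 1); last by rewrite z1.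
move=> w wr; rewrite horner_poly; apply: K0P; apply: le_trans wr _.
by rewrite lerD2l ler_wpM2r ?modulus_ge0 // ler_nat -ltnS.
Qed.

Hypothesis f_nonpoly : ~ exists p : {poly C}, forall z, f z = p.[z].

Lemma coef_infinite N0 : exists2 p, (N0 <= p)%N & c p != 0.
Proof.
apply: contrapT => h; apply: f_nonpoly; exists (\poly_(i < N0) c i) => z.
have c0 p : (N0 <= p)%N -> c p = 0.
  by move=> Np; apply/eqP; apply: contrapT => /negP cp; apply: h; exists p.
apply/eqP; rewrite -subr_eq0 -modulus_eq0 eq_le modulus_ge0 andbT.
apply/ler_addgt0Pr => e e0; rewrite add0r.
have [K0 K0P] := taylor_uniform (modulus z) e0.
have := K0P (maxn K0 N0) (leq_maxl _ _) z (lexx _).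
rewrite horner_poly; congr (modulus (_ - _) <= e).
rewrite [LHS](bigID (fun i : 'I_(maxn K0 N0) => i < N0)%N) /= [X in _ + X]big1 ?addr0.
  by rewrite -(big_ord_widen_cond _ xpredT (fun i => c i * z ^+ i)) // leq_maxr.
by move=> i; rewrite -leqNgt => /c0 ->; rewrite mul0r.
Qed.

Lemma central_exists (r : R) : 0 < r -> exists2 N, central c r N & c N != 0.
Proof.
move=> r0; have [p0 _ cp0] := coef_infinite 0.
(* At radius [4 * r] the loss in [c_bound] still leaves decay [2 ^- p], so the maximum is attained
   among finitely many terms. *)
have r4 : 0 < 4 * r by rewrite mulr_gt0.
have [M MP] := entire_bounded (4 * r) f_entire.
have cM p : modulus (c p) * r ^+ p <= M * 2^-1 ^+ p.
  have h : modulus (c p) <= M * (2 / (4 * r)) ^+ p.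
    by apply: c_bound => // z zr; apply: MP; rewrite zr.
  apply: le_trans (ler_wpM2r (exprn_ge0 p (ltW r0)) h) _.
  rewrite -mulrA -exprMn; have -> // : 2 / (4 * r) * r = 2^-1.
  by field; rewrite gt_eqF.
have v0 : 0 < modulus (c p0) * r ^+ p0 by rewrite mulr_gt0 ?modulus_gt0 ?exprn_gt0.
have [K0 K0P] := geometric_small M v0.
have argmax k : exists2 N, (N <= k)%N & forall p, (p <= k)%N ->
    modulus (c p) * r ^+ p <= modulus (c N) * r ^+ N.
  elim: k => [|k [N Nk NP]]; first by exists 0%N => // p; rewrite leqn0 => /eqP ->.
  have [h|/ltW h] := leP (modulus (c k.+1) * r ^+ k.+1) (modulus (c N) * r ^+ N).
    exists N; first exact: leqW.
    by move=> p; rewrite leq_eqVlt ltnS => /orP[/eqP -> //|/NP].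
  exists k.+1 => // p; rewrite leq_eqVlt ltnS => /orP[/eqP -> //|/NP h'].
  exact: le_trans h' h.
have [N _ NP] := argmax (maxn p0 K0).
have Nc : central c r N.
  move=> p; have [pk|kp] := leqP p (maxn p0 K0); first exact: NP.
  apply: le_trans (cM p) (le_trans (K0P p _) (NP p0 (leq_maxl _ _))).
  exact: leq_trans (leq_maxr _ _) (ltnW kp).
exists N => //; have := lt_le_trans v0 (Nc p0).
by rewrite pmulr_lgt0 ?exprn_gt0 // modulus_gt0.
Qed.

(** A nonzero coefficient of index at least [N0] eventually outweighs all terms of index below
    [N0]. *)
Lemma central_unbounded N0 :
  exists2 r0, 1 <= r0 & forall r N, r0 <= r -> central c r N -> (N0 <= N)%N.
Proof.
have [p Np cp] := coef_infinite N0.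
pose S := \sum_(i < N0) modulus (c i).
have S0 : 0 <= S by rewrite sumr_ge0 // => i _; exact: modulus_ge0.
have cp0 : 0 < modulus (c p) by rewrite modulus_gt0.
exists (1 + S / modulus (c p)); first by rewrite lerDl divr_ge0 // ltW.
move=> r N rr cen; rewrite leqNgt; apply/negP => NN0.
have Np' : (N < p)%N by exact: leq_trans NN0 Np.
have r1 : 1 <= r by apply: le_trans rr; rewrite lerDl divr_ge0 // ltW.
have r0 : 0 < r by apply: lt_le_trans r1.
have cS : modulus (c N) <= S.
  by rewrite /S (bigD1 (Ordinal NN0)) //= lerDl sumr_ge0 // => i _; exact: modulus_ge0.
have := cen p; apply/negP; rewrite -ltNge.
apply: (@le_lt_trans _ _ (S * r ^+ N)); first by rewrite ler_wpM2r // exprn_ge0 // ltW.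
have -> : r ^+ p = r ^+ (p - N.+1).+1 * r ^+ N by rewrite -exprD addSnnS subnK.
rewrite mulrA ltr_pM2r ?exprn_gt0 //.
apply: (@lt_le_trans _ _ (modulus (c p) * r)).
  by rewrite mulrC -ltr_pdivrMr //; apply: lt_le_trans rr; rewrite ltrDr.
by rewrite ler_pM2l // exprS ler_peMr ?exprn_ege1 // ltW.
Qed.

Lemma max_modulus_ub (r : R) z : modulus z = r -> modulus (f z) <= max_modulus f r.
Proof.
move=> zr; have [M MP] := entire_bounded r f_entire.
apply: ub_le_sup; last by exists z.
by exists M => _ [w wr <-]; apply: MP; rewrite /modulus wr.
Qed.

Lemma max_modulus_le (r M : R) : 0 <= r ->
  (forall z, modulus z = r -> modulus (f z) <= M) -> max_modulus f r <= M.
Proof.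
move=> r0 fM; apply: ge_sup; last by move=> _ [z zr <-]; exact: fM.
exists (modulus (f r%:C)), r%:C => //.
exact: etrans (modulus_real r) (ger0_norm r0).
Qed.

(** In the radius [2 * expR 1 * r], the 2 cancels the loss in [c_bound] and [expR 1] produces the
    factor [expR N]. *)
Lemma central_le_max_modulus (r : R) N : 0 < r -> central c r N ->
  forall p, modulus (c p) * r ^+ p * expR N%:R <= max_modulus f (2 * expR 1 * r).
Proof.
move=> r0 cen p; set rho := 2 * expR 1 * r.
have rho0 : 0 < rho by rewrite !mulr_gt0 ?expR_gt0.
have := c_bound N rho0 (fun z zr => max_modulus_ub zr).
set M := max_modulus f rho => h.
have e1 := expR_gt0 (1 : R).
have eN : expR N%:R = expR 1 ^+ N :> R by rewrite -expRM_natl mulr1.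
apply: (@le_trans _ _ (modulus (c N) * r ^+ N * expR N%:R)).
  by rewrite ler_wpM2r ?expR_ge0.
rewrite -mulrA eN -exprMn.
apply: le_trans (ler_wpM2r _ h) _; first by rewrite exprn_ge0 // mulr_ge0 // ltW.
rewrite -mulrA -exprMn; have -> : 2 / rho * (r * expR 1) = 1.
  by rewrite /rho; field; rewrite !gt_eqF.
by rewrite expr1n mulr1.
Qed.

(** Central at [2 * r], the terms at [r] are dominated by a geometric series of ratio 1/2. *)
Lemma max_modulus_le_central (r : R) N : 0 < r -> central c (2 * r) N ->
  max_modulus f r <= 2 * (modulus (c N) * (2 * r) ^+ N).
Proof.
move=> r0 cen; apply: max_modulus_le => [|z zr]; first exact: ltW.
set mu := modulus (c N) * (2 * r) ^+ N.
have mu0 : 0 <= mu by rewrite mulr_ge0 ?modulus_ge0 ?exprn_ge0 ?mulr_ge0 // ltW.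
apply/ler_addgt0Pr => e e0.
have [K0 /(_ K0 (leqnn _) z (lexx _)) h] := taylor_uniform (modulus z) e0.
rewrite -[X in modulus X](subrK (\sum_(m < K0) c m * z ^+ m)).
apply: le_trans (modulusD _ _) _; rewrite addrC lerD //.
apply: le_trans (modulus_sum _ _ _) _.
apply: (@le_trans _ _ (\sum_(m < K0 | (0 <= m)%N) mu * 2^-1 ^+ (m - 0))).
  apply: ler_sum => m _; rewrite subn0 modulusM modulusX zr.
  have := cen m; rewrite -/mu exprMn exprVn ler_pdivlMr ?exp2_gt0 //.
  by rewrite mulrAC -mulrA.
rewrite -mulr_sumr mulrC ler_wpM2r //; apply: geometric_tail => //.
Qed.

End EntireGrowth.

(** * Order of growth in terms of the central index *)

Section Growth.
Variable R : realType.
Local Notation C := R[i].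

Lemma limf_esup_lt (g : R -> R) (x : R) :
  (limf_esup (fun r => (g r)%:E) (+oo)%R < x%:E)%E ->
  exists r0, forall r, r0 < r -> g r < x.
Proof.
rewrite limf_esupE => /ereal_inf_lt[_ [A [M [_ MA]] <-] Ax].
exists M => r /MA Ar; rewrite -lte_fin; apply: le_lt_trans Ax.
by apply: ereal_sup_ubound; exists r.
Qed.

Lemma limf_esup_gt (g : R -> R) (x : R) :
  (x%:E < limf_esup (fun r => (g r)%:E) (+oo)%R)%E ->
  forall r0, exists2 r, r0 < r & x < g r.
Proof.
rewrite limf_esupE => h r0.
have : (x%:E < ereal_sup [set (g r)%:E | r in [set r | (r0 < r)%R]])%E.
  apply: lt_le_trans h _; apply: ereal_inf_lbound.
  by exists [set r | r0 < r]%classic => //; exists r0; split=> //; exact: num_real.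
by move=> /ereal_sup_gt[_ [r r0r <-]]; rewrite lte_fin; exists r.
Qed.

Lemma ln_eventually (B d : R) : 0 < d ->
  exists2 r0, 1 <= r0 & forall r, r0 <= r -> B <= d * ln r.
Proof.
move=> d0; exists (expR (`|B| / d)).
  by rewrite -(expR0 R) ler_expR divr_ge0 // ltW.
move=> r rr; apply: le_trans (ler_norm _) _; rewrite mulrC -ler_pdivrMr //.
by rewrite -[leLHS]expRK ler_ln ?posrE ?expR_gt0 // (lt_le_trans (expR_gt0 _) rr).
Qed.

Lemma lnln_le (d r : R) : 0 < d -> 0 < ln r -> ln (ln r) <= d * ln r - ln d.
Proof.
move=> d0 l0; have p : 0 < d * ln r by rewrite mulr_gt0.
by have := ln_sublinear p; rewrite lnM ?posrE //; lra.
Qed.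

(** For [y <= 0] the default value of [ln] does no harm, the right side being positive. *)
Lemma le_expR_ln (y t : R) : ln y <= t -> y <= expR t.
Proof.
move=> h; have [y0|y0] := leP y 0; first exact: le_trans y0 (expR_ge0 _).
by rewrite -[leLHS]lnK ?posrE // ler_expR.
Qed.

Lemma ln_natr_ge0 N : 0 <= ln (N%:R : R).
Proof. by case: N => [|N]; [rewrite ln0|rewrite ln_ge0 // ler1n]. Qed.

Variables (f : C -> C) (c : nat -> C).
Hypothesis f_entire : entire f.
Hypothesis c_bound : forall (r M : R) m, 0 < r ->
  (forall z, modulus z = r -> modulus (f z) <= M) -> modulus (c m) <= M * (2 / r) ^+ m.
Hypothesis c_approx : forall (r M : R) k w, 0 < r ->
  (forall z, modulus z <= 4 * r -> modulus (f z) <= M) -> modulus w <= r ->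
  modulus (f w - \sum_(m < k) c m * w ^+ m) <= M * (modulus w / r) ^+ k.
Hypothesis f_nonpoly : ~ exists p : {poly C}, forall z, f z = p.[z].

Let M := max_modulus f.
Let rho (r : R) := 2 * expR 1 * r.

Let e2_ge1 : 1 <= 2 * expR 1 :> R.
Proof.
have : 1 <= expR 1 :> R by rewrite -{1}(expR0 R) ler_expR.
by move=> h; rewrite (le_trans h) // ler_peMl ?expR_ge0 // ler1n.
Qed.

Lemma central_le_ln : exists v : R, forall (r : R) N, 1 <= r -> central c r N ->
  N%:R <= ln (M (rho r)) + v.
Proof.
have [p _ cp] := coef_infinite f_entire c_approx f_nonpoly 0.
have cp0 : 0 < modulus (c p) by rewrite modulus_gt0.
exists (- ln (modulus (c p))) => r N r1 cen.
have r0 : 0 < r by apply: lt_le_trans r1.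
have := central_le_max_modulus f_entire c_bound r0 cen p; rewrite -/(rho r) -/M => h.
have h1 : modulus (c p) * expR N%:R <= M (rho r).
  apply: le_trans h; rewrite ler_wpM2r ?expR_ge0 // ler_peMr ?modulus_ge0 //.
  by rewrite exprn_ege1.
have h2 : 0 < modulus (c p) * expR N%:R by rewrite mulr_gt0 ?expR_gt0.
have : ln (modulus (c p) * expR N%:R) <= ln (M (rho r)).
  by rewrite ler_ln ?posrE // (lt_le_trans h2).
by rewrite lnM ?posrE ?expR_gt0 // expRK; lra.
Qed.

(** Eventually [ln (M (rho r)) <= rho r ^ x], so [N] is at most a constant times [r ^ x]; the gap
    [x' - x] swallows the constant. *)
Lemma growth_upper (x x' : R) : 0 <= x -> x < x' ->
  (growth_order f < x%:E)%E -> exists2 r0, 1 <= r0 &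
  forall r N, r0 <= r -> central c r N -> ln N%:R <= x' * ln r.
Proof.
move=> x0 xx' /limf_esup_lt[r1 r1P].
have [v vP] := central_le_ln.
have dx : 0 < x' - x by rewrite subr_gt0.
have [r2 r21 r2P] := ln_eventually (ln (1 + `|v|) + x * ln (2 * expR 1)) dx.
exists (`|r1| + 1 + r2).
  by have := normr_ge0 r1; lra.
move=> r N rr cen.
have rr1 : `|r1| + 1 <= r by lra.
have rr2 : r2 <= r by have := normr_ge0 r1; lra.
have r1' : 1 <= r by exact: le_trans rr2.
have r0 : 0 < r by apply: lt_le_trans r1'.
have rho_r : r <= rho r by rewrite /rho ler_peMl // ltW.
have rho1 : 1 <= rho r by exact: le_trans rho_r.
have lnrho : 0 < ln (rho r).
  rewrite ln_gt0 // /rho; apply: lt_le_trans (_ : 2 * expR 1 <= _); last first.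
    by rewrite ler_peMr // (le_trans ler01).
  have : 1 <= expR 1 :> R by rewrite -{1}(expR0 R) ler_expR.
  lra.
have r1rho : r1 < rho r.
  by apply: lt_le_trans rho_r; have := ler_norm r1; lra.
have := r1P _ r1rho; rewrite ltr_pdivrMr // -/M => hM.
have hM' : ln (M (rho r)) <= expR (x * ln (rho r)).
  exact: le_expR_ln (ltW hM).
have ex1 : 1 <= expR (x * ln (rho r)).
  by rewrite -(expR0 R) ler_expR mulr_ge0 // ltW.
have hN : N%:R <= (1 + `|v|) * expR (x * ln (rho r)).
  apply: le_trans (vP r N r1' cen) _; rewrite mulrDl mul1r lerD //.
  by rewrite (le_trans (ler_norm _)) // ler_peMr.
have v1 : 0 < 1 + `|v| by rewrite ltr_wpDr.
case: N cen hN => [|N] cen hN.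
  by rewrite ln0 // mulr_ge0 ?ln_ge0 // (le_trans x0) // ltW.
have : ln N.+1%:R <= ln ((1 + `|v|) * expR (x * ln (rho r))).
  by rewrite ler_ln ?posrE ?mulr_gt0 ?expR_gt0.
rewrite lnM ?posrE ?expR_gt0 // expRK /rho [ln (_ * r)]lnM ?posrE ?mulr_gt0 ?expR_gt0 //.
have := r2P r rr2.
rewrite mulrBl mulrDr; move: (ln (_ + _)) (ln r) (ln (2 * _)) (ln N.+1%:R) => A B D E.
move: (x * B) (x' * B) (x * D) => F G H; lra.
Qed.

(** From [M r' <= W * r ^ N] with [r = 2 * r'] follows [ln (M r') <= 2 * N * ln r]. On taking
    logarithms, one half of [x - x'] absorbs the constants and the other [ln (ln r)]. *)
Lemma growth_lower (x x' : R) : 0 <= x -> x' < x ->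
  (x%:E < growth_order f)%E -> forall r0, exists2 r, r0 <= r &
  forall N, (0 < N)%N -> central c r N -> x' * ln r <= ln N%:R.
Proof.
move=> x0 xx' /limf_esup_gt gx r0.
(* At radius 2 the loss factor in [c_bound] is 1, so [M 2] bounds every coefficient. *)
pose W := 1 + 2 * M 2.
have M20 : 0 <= M 2.
  apply: le_trans (modulus_ge0 (f 2%:C)) (max_modulus_ub f_entire _).
  by rewrite modulus_real ger0_norm.
have W1 : 1 <= W by rewrite /W lerDl mulr_ge0.
pose d := (x - x') / 2.
have d0 : 0 < d by rewrite divr_gt0 // subr_gt0.
have [r1 r11 r1P] := ln_eventually (x * ln 2 + ln 2 - ln d) d0.
have [r2 r21 r2P] := ln_eventually (ln W + 1) ltr01.
have [r' r'0] := gx (`|r0| + r1 + r2); rewrite -/M.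
have n0 := normr_ge0 r0; have n0' := ler_norm r0.
have r'1 : 1 < r' by lra.
have r'p : 0 < r' by lra.
have lr' : 0 < ln r' by rewrite ln_gt0.
rewrite ltr_pdivlMr // => hM.
exists (2 * r') => [|N N0 cen]; first lra.
set r := 2 * r'.
have rr1 : r1 <= r by rewrite /r; lra.
have rr2 : r2 <= r by rewrite /r; lra.
have r1' : 1 <= r by rewrite /r; lra.
have rp : 0 < r by rewrite /r; lra.
have lnr : ln r = ln 2 + ln r' by rewrite /r lnM ?posrE.
have h1 := r1P r rr1; have := r2P r rr2; rewrite mul1r => h2.
have lW : 0 <= ln W by rewrite ln_ge0.
have lr0 : 0 < ln r by lra.
have xl : 0 <= x * ln r' by rewrite mulr_ge0 // ltW.
have lM1 : 1 < ln (M r').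
  rewrite ltNge; apply/negP => /ln_le0; lra.
have Mp : 0 < M r'.
  rewrite ltNge; apply/negP => h.
  by have := ln_le0 (le_trans h ler01); lra.
have MW : M r' <= W * r ^+ N.
  apply: le_trans (max_modulus_le_central f_entire c_approx r'p cen) _.
  rewrite -/r mulrA ler_wpM2r ?exprn_ge0 ?(ltW rp) //.
  have := c_bound N (ltr0n R 2) (fun z zr => max_modulus_ub f_entire zr).
  rewrite divff ?pnatr_eq0 // expr1n mulr1 -/M /W; lra.
have N1 : 1 <= N%:R :> R by rewrite ler1n.
have lM2 : ln (M r') <= 2 * N%:R * ln r.
  have Wp : 0 < W by exact: lt_le_trans W1.
  have := MW; rewrite -ler_ln ?posrE ?mulr_gt0 ?exprn_gt0 // lnM ?posrE ?exprn_gt0 //.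
  rewrite lnXn // -[ln r *+ N]mulr_natl => h; apply: le_trans h _.
  have := ler_wpM2r (ltW lr0) N1; rewrite mul1r -mulrA mulr2n mulrDl mul1r => h.
  rewrite lerD2r; lra.
have : ln (ln (M r')) <= ln 2 + ln N%:R + ln (ln r).
  have NR : 0 < N%:R :> R by rewrite ltr0n.
  rewrite -lnM ?posrE // -lnM ?posrE ?mulr_gt0 // ler_ln ?posrE ?mulr_gt0 //.
  exact: lt_trans ltr01 lM1.
have := lnln_le d0 lr0.
have e1 : x * ln r = x * ln 2 + x * ln r' by rewrite lnr mulrDr.
have e2 : x' * ln r = x * ln r - d * ln r - d * ln r by rewrite /d; field.
rewrite e2 e1; move: h1 hM.
move: (x * ln 2) (x * ln r') (d * ln r) (ln (ln (M r'))) (ln (ln r)) (ln N%:R) (ln d) (ln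
  2).
move=> q1 q2 q3 q4 q5 q6 q7 q8; lra.
Qed.

(** Excludes the value -oo, so that an order below 1 is a real number: large central indices force
    [ln (M r) >= 1]. *)
Lemma growth_order_ge0 : (0 <= growth_order f)%E.
Proof.
rewrite leNgt; apply/negP => /limf_esup_lt[r1 r1P].
have [v vP] := central_le_ln.
have [r2 r21 r2P] := central_unbounded f_entire c_approx f_nonpoly (Num.trunc (`|v| +
  1)).+1.
pose r := r2 + `|r1| + 1.
have n0 := normr_ge0 r1; have n1 := ler_norm r1.
have rr1 : 1 <= r by rewrite /r; lra.
have rp : 0 < r by exact: lt_le_trans rr1.
have [N cen cN] := central_exists f_entire c_bound c_approx f_nonpoly rp.
have rr2 : r2 <= r by rewrite /r; lra.
have := r2P _ _ rr2 cen; rewrite -(ler_nat R) => hN.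
have hN2 := lt_le_trans (Num.Theory.truncnS_gt (`|v| + 1)) hN.
have h := vP _ _ rr1 cen; have nv := ler_norm v.
have lM : 1 <= ln (M (rho r)) by lra.
have rho_r : r <= rho r by rewrite /rho ler_peMl // ltW.
have r1rho : r1 < rho r by apply: lt_le_trans rho_r; rewrite /r; lra.
have := r1P _ r1rho; rewrite -/M; apply/negP; rewrite -leNgt divr_ge0 ?ln_ge0 //.
exact: le_trans rho_r.
Qed.

End Growth.

(** * The Newton-Puiseux diagram *)

Section NewtonPuiseux.
Variable R : realType.
Local Notation C := R[i].

(** The power of [r] that [weight r N j] amounts to when [N] is [r ^ sigma]. *)
Definition exponent n (a : 'I_n.+1 -> {poly C}) (sigma : R) (j : 'I_n.+1) : R :=
  j%:R * sigma + (size (a j)).-1%:R - j%:R.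

(** The half-plane [H] is convex and contains all points of the diagram, hence their hull; the
    segment between the two maximizers lies on its boundary line, of slope [- sigma]. *)
Lemma gradient_of_double_max n (a : 'I_n.+1 -> {poly C}) (sigma : R)
    (j1 j2 : 'I_n.+1) : a j1 != 0 -> a j2 != 0 -> (j1 < j2)%N ->
  exponent a sigma j1 = exponent a sigma j2 ->
  (forall j, a j != 0 -> exponent a sigma j <= exponent a sigma j1) ->
  newton_puiseux_gradient a sigma.
Proof.
move=> a1 a2 j12 e12 emax; exists (- sigma); last by rewrite opprK.
pose pt (j : 'I_n.+1) : convex_lmodType (R^o * R^o)%type :=
  (j%:R, (size (a j)).-1%:R - j%:R).
have j12R : (j1%:R : R) < j2%:R by rewrite ltr_nat.
exists (pt j1), (pt j2); split=> //; last first.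
  rewrite /=; move: e12; rewrite /exponent => e12.
  have d0 : (j2%:R - j1%:R : R) != 0 by rewrite subr_eq0 gt_eqF.
  apply: (mulIf d0); rewrite divfK //; lra.
move=> t; split.
  move=> B [Bc AB].
  have Bp j : a j != 0 -> pt j \in B by move=> aj; rewrite inE; apply: AB; exists j.
  by have := Bc _ _ t (Bp _ a1) (Bp _ a2); rewrite inE.
move=> y hy.
pose H := [set u : (R^o * R^o)%type | u.2 + sigma * u.1 <= exponent a sigma j1]%classic.
have {}hy : H ((conv t (pt j1) (pt j2)).1, y).
  apply: hy; split; last first.
    move=> _ [j aj <-]; rewrite /H /=; apply: le_trans (emax j aj).
    by rewrite /exponent mulrC; lra.
  move=> u v s; rewrite !inE /H /= => hu hv.
  have s0 : 0 <= s%:num by exact: ge0.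
  have s1 : 0 <= 1 - s%:num by rewrite subr_ge0; exact: le1.
  rewrite /conv /= /GRing.scale /= /unstable.onem.
  have := lerD (ler_wpM2l s0 hu) (ler_wpM2l s1 hv).
  rewrite -mulrDl addrCA subrr addr0 mul1r; apply: le_trans.
  by rewrite le_eqVlt; apply/orP; left; apply/eqP; ring.
move: hy; rewrite /H /= /conv /= /GRing.scale /= /unstable.onem => hy.
have E j : (size (a j)).-1%:R - j%:R = exponent a sigma j - sigma * j%:R.
  by rewrite /exponent; ring.
rewrite !E -e12; move: hy; set e := exponent _ _ _.
set u := (t%:num); set x1 := (j1%:R : R); set x2 := (j2%:R : R).
have -> : u * (e - sigma * x1) + (1 - u) * (e - sigma * x2) =
  e - sigma * (u * x1 + (1 - u) * x2) by ring.
lra.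
Qed.

Variables (eta : C) (n : nat) (a : 'I_n.+1 -> {poly C}) (f : C -> C).
Hypotheses (eta_neq0 : eta != 0) (f_entire : entire f).
Hypothesis f_nonpoly : ~ exists p : {poly C}, forall z, f z = p.[z].
Hypothesis f_solution : forall z,
  \sum_(j < n.+1) (a j).[z] * iter j (difference eta) f z = 0.

Lemma ln_weight (r : R) N j : 0 < r -> (0 < N)%N ->
  ln (weight a r N j) = j%:R * (ln N%:R - ln r) + (size (a j)).-1%:R * ln r.
Proof.
move=> r0 N0; have NR : 0 < N%:R :> R by rewrite ltr0n.
have q0 : 0 < N%:R / r by rewrite divr_gt0.
by rewrite /weight lnM ?posrE ?exprn_gt0 // !lnXn // ln_div ?posrE // !mulr_natl.
Qed.

(* When [sigma = 0] a tie in the exponents is broken by [N -> oo]. *)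
Lemma no_dominant_exponent (sigma : R) (j0 : 'I_n.+1) :
  growth_order f = sigma%:E -> 0 <= sigma -> sigma < 1 -> a j0 != 0 ->
  ~ (forall j, a j != 0 -> j != j0 ->
       exponent a sigma j < exponent a sigma j0 \/
       [/\ exponent a sigma j = exponent a sigma j0, sigma = 0 & (j < j0)%N]).
Proof.
move=> fs s0 s1 aj0 dom.
have [c [c_bound c_approx]] := taylor_expansion f_entire.
have [kappa [k0 [N0 kP]]] := no_dominant_weight eta_neq0 aj0
  (operator_truncation f_entire c_approx f_solution).
pose gap (j : 'I_n.+1) := exponent a sigma j0 - exponent a sigma j.
pose delta := \big[Num.min/1]_(j | 0 < gap j) gap j.
have d0 : 0 < delta by rewrite /delta; elim/big_ind: _ => // x y x0 y0; rewrite lt_min x0.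
have dP j : exponent a sigma j < exponent a sigma j0 -> delta <= gap j.
  by rewrite -subr_gt0 => h; rewrite /delta (bigD1 j) //= ge_min lexx.
(* An error [eps] in the order, multiplied by [|j - j0|], must cost at most half the gap [delta];
   the second bound keeps [sigma + eps] below 1, whence [N <= kappa * r]. *)
pose eps := Num.min (delta / (2 * n.+1%:R)) ((1 - sigma) / 2).
have nn : 0 < 2 * n.+1%:R :> R by rewrite mulr_gt0.
have e0 : 0 < eps by rewrite lt_min !divr_gt0 // subr_gt0.
have ed : eps * (2 * n.+1%:R) <= delta.
  by rewrite -ler_pdivlMr // ge_min lexx.
have e1 : eps <= (1 - sigma) / 2 by rewrite ge_min lexx orbT.
have x0 : 0 <= sigma + eps / 2 by rewrite addr_ge0 // divr_ge0 // ltW.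
have xx' : sigma + eps / 2 < sigma + eps by rewrite ltrD2l ltr_pdivrMr // ltr_pMr // ltr1n.
have gx : (growth_order f < (sigma + eps / 2)%:E)%E.
  by rewrite fs lte_fin ltrDl divr_gt0.
have [r1 r11 up] := growth_upper f_entire c_bound c_approx f_nonpoly x0 xx' gx.
(* If [sigma - eps <= 0], then [ln N >= 0] is enough; otherwise [growth_lower] applies. *)
have low : forall r0, exists2 r, r0 <= r & forall N, (0 < N)%N -> central c r N ->
    (sigma - eps) * ln r <= ln N%:R.
  move=> r0; have [h|h] := leP (sigma - eps) 0.
    exists (Num.max r0 1); first by rewrite le_max lexx.
    move=> N _ _; apply: le_trans (ln_natr_ge0 R N).
    by rewrite mulr_le0_ge0 // ln_ge0 // le_max lexx orbT.
  apply: (growth_lower f_entire c_bound c_approx (x := sigma - eps / 2)).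
  - lra.
  - lra.
  - by rewrite fs lte_fin ltrBlDr ltrDl divr_gt0.
have d2 : 0 < delta / 2 by rewrite divr_gt0.
have g0 : 0 < 1 - sigma - eps by lra.
have [r2 r21 r2P] := ln_eventually (- ln kappa) g0.
have [r3 r31 r3P] := ln_eventually (- ln kappa) d2.
have [r4 r41 r4P] := central_unbounded f_entire c_approx f_nonpoly
  (N0 + (Num.trunc kappa^-1).+1).
have kV : 0 < kappa^-1 by rewrite invr_gt0.
have [r rr low_r] := low (r1 + r2 + r3 + r4 + kappa^-1).
have r_1 : r1 <= r by lra.
have r_2 : r2 <= r by lra.
have r_3 : r3 <= r by lra.
have r_4 : r4 <= r by lra.
have r_k : kappa^-1 <= r by lra.
have r0 : 0 < r by lra.
have [N cen cN] := central_exists f_entire c_bound c_approx f_nonpoly r0.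
have hN := r4P r N r_4 cen.
have NN0 : (N0 <= N)%N by exact: leq_trans (leq_addr _ _) hN.
have Npos : (0 < N)%N by apply: leq_trans hN; rewrite addnS.
have NR : 0 < N%:R :> R by rewrite ltr0n.
have Nk : kappa^-1 < N%:R.
  apply: lt_le_trans (Num.Theory.truncnS_gt _) _.
  by rewrite ler_nat (leq_trans (leq_addl _ _) hN).
have lnk : - ln kappa < ln N%:R by rewrite -lnV ?posrE // ltr_ln ?posrE.
have upN := up r N r_1 cen; have lowN := low_r N Npos cen.
have h2 := r2P r r_2; have h3 := r3P r r_3.
have L0 : 0 <= ln r by rewrite ln_ge0 //; lra.
have Nkr : N%:R <= kappa * r.
  rewrite -ler_ln ?posrE ?mulr_gt0 // lnM ?posrE //.
  move: h2; rewrite !mulrBl mul1r; rewrite mulrDl in upN; lra.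
have [j [aj jj]] := kP r N r_k NN0 Nkr cen cN.
have Vpos i : 0 < weight a r N i by rewrite mulr_gt0 ?exprn_gt0 ?divr_gt0.
have kW : 0 < kappa * weight a r N j0 by rewrite mulr_gt0.
rewrite -ltr_ln ?posrE ?Vpos ?kW // (lnM k0 (Vpos j0)) !ln_weight //.
(* The deviation of [N] from [r ^ sigma] on the logarithmic scale. *)
pose th := ln N%:R - sigma * ln r.
have th1 : th <= eps * ln r by rewrite /th; rewrite mulrDl in upN; lra.
have th2 : - (eps * ln r) <= th by rewrite /th; rewrite mulrBl in lowN; lra.
have diffE : j%:R * (ln N%:R - ln r) + (size (a j)).-1%:R * ln r -
    (j0%:R * (ln N%:R - ln r) + (size (a j0)).-1%:R * ln r) =
    (j%:R - j0%:R) * th - gap j * ln r by rewrite /th /gap /exponent; ring.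
have [lt|[eq sig0 jlt]] := dom j aj jj => hlt; last first.
  (* With [sigma = 0] and equal exponents the weights differ by a power of [N] of exponent at most
     -1, and [N] exceeds [kappa^-1]. *)
  have gap0 : gap j = 0 by rewrite /gap eq subrr.
  rewrite gap0 mul0r subr0 /th sig0 mul0r subr0 in diffE.
  have j1 : (j%:R - j0%:R : R) <= -1 by rewrite lerBlDr addrC lerBrDr natr1 ler_nat.
  have := ler_wpM2r (ln_natr_ge0 R N) j1; rewrite -diffE mulN1r.
  move: lnk hlt; clear; lra.
have hgap := ler_wpM2r L0 (dP j lt).
have jn : `|(j%:R - j0%:R : R)| <= n.+1%:R.
  have := ltn_ord j; have := ltn_ord j0; rewrite -!(ltr_nat R).
  have := ler0n R j; have := ler0n R j0.
  by rewrite ler_norml => *; apply/andP; split; lra.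
have thb : `|th| <= eps * ln r by rewrite ler_norml th1 th2.
have hth : (j%:R - j0%:R) * th <= n.+1%:R * (eps * ln r).
  by rewrite (le_trans (ler_norm _)) // normrM ler_pM.
have hed := ler_wpM2r L0 ed.
have e2 : eps * (2 * n.+1%:R) * ln r = 2 * (n.+1%:R * (eps * ln r)) by ring.
have e3 : delta / 2 * ln r = delta * ln r / 2 by ring.
rewrite e2 in hed; rewrite e3 in h3.
move: diffE hlt hgap hth hed h3; move: (_ * th) (gap j * _) (_ * (eps * _)) (delta * _)
  => u v w x.
move: (_ + _ * ln r) (_ + _ * ln r) => y z; lra.
Qed.

End NewtonPuiseux.

Theorem theorem7p3 (R : realType) (eta : R[i]) (eta_neq0 : eta != 0)
    (n : nat) (a : 'I_n.+1 -> {poly R[i]})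
    (a_neq0 : exists j : 'I_n.+1, a j != 0)
    (f : R[i] -> R[i]) (f_transcendental : transcendental_entire f)
    (f_solution : forall z : R[i],
      \sum_(j < n.+1) (a j).[z] * iter j (difference eta) f z = 0)
    (f_order : (growth_order f < 1%:E)%E) :
  exists chi : rat,
    [/\ growth_order f = (ratr chi : R)%:E,
        newton_puiseux_gradient a (ratr chi : R) &
        0 < chi].
Proof.
have [f_entire f_nonpoly] := f_transcendental.
have [c [c_bound c_approx]] := taylor_expansion f_entire.
have ge0 := growth_order_ge0 f_entire c_bound c_approx f_nonpoly.
have [sigma fs] : exists sigma : R, growth_order f = sigma%:E.
  by case: (growth_order f) f_order ge0 => [x _ _|//|//]; exists x.
move: f_order ge0; rewrite fs lee_fin lte_fin => s1 s0.
have nodom j0 := no_dominant_exponent eta_neq0 f_entire f_nonpoly f_solution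
  (j0 := j0) fs s0 s1.
have [i0 ai0] := a_neq0.
have [jmax ajmax jmaxP] : exists2 j1, a j1 != 0 &
    forall j, a j != 0 -> exponent a sigma j <= exponent a sigma j1.
  have [i ai iP] := arg_maxP (P := fun j => a j != 0) (exponent a sigma) ai0.
  by exists i.
pose Q j := (a j != 0) && (exponent a sigma j == exponent a sigma jmax).
have Qmax : Q jmax by rewrite /Q ajmax eqxx.
(* The largest maximizer, so that every tie has a smaller index, as the tie-break at [sigma = 0]
   demands. *)
have [j1 /andP[aj1 /eqP ej1] j1P] := arg_maxnP (fun j : 'I_n.+1 => j : nat) Qmax.
have jP j : a j != 0 -> exponent a sigma j <= exponent a sigma j1.
  by rewrite ej1; exact: jmaxP.
have lej j : a j != 0 -> exponent a sigma j < exponent a sigma j1 \/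
    exponent a sigma j = exponent a sigma j1.
  by move=> /jP; rewrite le_eqVlt => /orP[/eqP|]; [right|left].
have tie j : a j != 0 -> j != j1 -> exponent a sigma j = exponent a sigma j1 -> (j < j1)%N.
  move=> aj jj e; rewrite ltn_neqAle val_eqE jj /=; apply: j1P.
  by rewrite /Q aj e ej1 eqxx.
have s_gt0 : 0 < sigma.
  rewrite lt_neqAle s0 andbT; apply/eqP => s00; apply: (nodom j1 aj1) => j aj jj.
  have [|e] := lej j aj; first by left.
  by right; split=> //; exact: tie.
have [j2 [aj2 j21 e21]] : exists j2, [/\ a j2 != 0, (j2 < j1)%N &
    exponent a sigma j2 = exponent a sigma j1].
  apply: contrapT => h; apply: (nodom j1 aj1) => j aj jj.
  have [|e] := lej j aj; first by left.
  by case: h; exists j; split=> //; exact: tie.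
(* The solution [sigma] of [exponent a sigma j1 = exponent a sigma j2]. *)
pose chi : rat := 1 - ((size (a j1)).-1%:R - (size (a j2)).-1%:R) / (j1%:R - j2%:R).
have j21R : (j2%:R : R) < j1%:R by rewrite ltr_nat.
have chiE : ratr chi = sigma :> R.
  rewrite /chi rmorphB fmorph_div !rmorphB /= !rmorph_nat rmorph1.
  have d0 : (j1%:R - j2%:R : R) != 0 by rewrite subr_eq0 gt_eqF.
  apply: (mulIf d0); rewrite mulrBl mul1r divfK //.
  by move: e21; rewrite /exponent; lra.
exists chi; rewrite chiE; split=> //.
  apply: (gradient_of_double_max aj2 aj1 j21 e21) => j aj.
  by rewrite e21; exact: jP.
by rewrite -(ltr0q R) chiE.
Qed.
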